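(* Let $X,Y$ be two disjoint compact sets in $\Omega\subset\mathbb{R}^2$ and let $\mathbf{x}_c\in X$, $\mathbf{y}_c\in Y$ be their centers respectively. Let $|\mathbf{x}_c-\mathbf{y}_c|=\rho=O(1)$, $\sup_{\mathbf{x}\in X}|\mathbf{x}_c-\mathbf{x}|=\zeta$ and $\sup_{\mathbf{y}\in Y}|\mathbf{y}_c-\mathbf{y}|=\eta$, and assume that $\frac{\zeta+\eta}{\rho}<\frac12$. Then for any $\varepsilon>0$ there exist $N^{\varepsilon}\le O\big((n+|\log\varepsilon|)^2\,\varepsilon^{-4/(k+1)}\big)$ and functions $f_l\in L^{\infty}(X)$, $g_l\in L^{\infty}(Y)$, $l=1,2,\dots,N^{\varepsilon}$, such that $$\Big\|\frac{E(\mathbf{x},\mathbf{y})}{|\mathbf{x}-\mathbf{y}|}\,e^{-in\arg(\mathbf{x}-\mathbf{y})}-\sum_{l=1}^{N^{\varepsilon}}f_l(\mathbf{x})\,g_l(\mathbf{y})\Big\|_{L^{\infty}(X\times Y)}\le\varepsilon,$$ where the constant in the upper bound for $N^{\varepsilon}$ depends on $X$ and $Y$.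
   Context: $\Omega\subset\mathbb{R}^2$ is a bounded convex domain. The coefficient $\sigma_t$ is a real-valued function in $C^{k+1}(\overline{\Omega})$ with $k\ge1$ an integer, and $0<\sigma_0\le\sigma_t\le\sigma_1<\infty$ for some constants $\sigma_0,\sigma_1$; $\Omega$, $\sigma_t$ and $k$ are fixed. For $\mathbf{x}\ne\mathbf{y}$ in $\Omega$, $$E(\mathbf{x},\mathbf{y})=\exp\Big(-|\mathbf{x}-\mathbf{y}|\int_0^1\sigma_t(\mathbf{x}+(\mathbf{y}-\mathbf{x})s)\,ds\Big).$$ $n$ is a nonnegative integer and $\arg(\mathbf{x}-\mathbf{y})$ is the polar angle of $\mathbf{x}-\mathbf{y}\in\mathbb{R}^2$. The ''centers'' are simply designated points of $X$ and $Y$; $\rho=O(1)$ says only that $\rho$ is a fixed quantity of order one. The bound on $N^{\varepsilon}$ is asymptotic as $\varepsilon\to0$: there is a constant $C$, independent of $n$ and $\varepsilon$, such that $N^{\varepsilon}\le C\,(n+|\log\varepsilon|)^2\varepsilon^{-4/(k+1)}$ for all sufficiently small $\varepsilon$. *)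

(* Defs.v *)
From HB Require Import structures.
From mathcomp Require Import all_boot all_order all_algebra.
From mathcomp Require Import all_classical all_reals all_analysis.
From mathcomp Require Import complex.
Set Implicit Arguments.
Unset Strict Implicit.
Unset Printing Implicit Defensive.
Import Order.TTheory GRing.Theory Num.Theory.
Import numFieldNormedType.Exports.
Local Open Scope classical_set_scope.
Local Open Scope ring_scope.

(* Points of the plane are pairs.  The library norm on R * R is the max norm
   (with the same topology), so the Euclidean length is defined separately. *)
Definition enorm {R : realType} (z : R * R) : R :=
  Num.sqrt (z.1 ^+ 2 + z.2 ^+ 2).

(* Principal value of the argument, in ]-pi, pi] for z != 0. *)
Definition parg {R : realType} (z : R * R) : R :=
  if 0 <= z.2 then acos (z.1 / enorm z) else - acos (z.1 / enorm z).

Definition cexpi {R : realType} (t : R) : R[i] := Complex (cos t) (sin t).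

(* f belongs to C^m(closure Omega): f is continuous on closure Omega, and all
   its partial derivatives of order at most m exist in Omega and extend
   continuously to closure Omega (g is the extension of a first partial). *)
Fixpoint Ck_closure {R : realType} (Omega : set (R * R)) (m : nat)
    (f : R * R -> R) : Prop :=
  {within closure Omega, continuous f} /\
  match m with
  | 0 => True
  | m'.+1 => forall v : R * R, v = (1, 0) \/ v = (0, 1) ->
      exists g : R * R -> R,
        (forall x, Omega x -> derivable f x v /\ 'D_v f x = g x) /\
        Ck_closure Omega m' g
  end.

Definition attenuation {R : realType} (sigma_t : R * R -> R) (x y : R * R) : R :=
  expR (- (enorm (x - y) *
    (\int[@lebesgue_measure R]_(s in `[0, 1]) sigma_t (x + s *: (y - x))))).

Definition kernel_n {R : realType} (sigma_t : R * R -> R) (n : nat)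
    (x y : R * R) : R[i] :=
  real_complex R (attenuation sigma_t x y / enorm (x - y)) *
  cexpi (- (n%:R * parg (x - y))).

Definition lebesgue2 (R : realType) :
    set (measurableTypeR R * measurableTypeR R) -> \bar R :=
  (@lebesgue_measure R \x @lebesgue_measure R)%E.

Arguments lebesgue2 : clear implicits.

HB.instance Definition _ (R : realType) := Measure.on (lebesgue2 R).

(* On a product measure the library infers sigma-finiteness only for
   subprobabilities. *)
Lemma lebesgue2_sigma_finite (R : realType) : sigma_finite setT (lebesgue2 R).
Proof.
have /sigma_finiteP[F [TF ndF Foo]] := sigma_finiteT (@lebesgue_measure R).
exists (fun n => F n `*` F n).
  rewrite -setXTT TF predeqE => -[x y]; split.
    move=> [/= [n _ Fnx] [k _ Gky]]; exists (maxn n k) => //; split.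
    - by move: x Fnx; exact/subsetPset/ndF/leq_maxl.
    - by move: y Gky; exact/subsetPset/ndF/leq_maxr.
  by move=> [n _ []/= ? ?]; split; exists n.
move=> k; have [? ?] := Foo k.
split; first exact: measurableX.
by rewrite /lebesgue2 product_measure1E// lte_mul_pinfty// ge0_fin_numE.
Qed.

HB.instance Definition _ (R : realType) :=
  Measure_isSigmaFinite.Build _ _ _ (lebesgue2 R) (@lebesgue2_sigma_finite R).

Definition lebesgue22 (R : realType) :
    set ((measurableTypeR R * measurableTypeR R) *
         (measurableTypeR R * measurableTypeR R)) -> \bar R :=
  (lebesgue2 R \x lebesgue2 R)%E.

Arguments lebesgue22 : clear implicits.

HB.instance Definition _ (R : realType) := Measure.on (lebesgue22 R).

(* L^oo norm over D of a complex-valued function: it is extended by 0 outside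
   D, so that the norm with respect to mu is the one with respect to mu
   restricted to D. *)
Definition Loo_norm {d} {T : measurableType d} {R : realType}
    (mu : {measure set T -> \bar R}) (D : set T) (f : T -> R[i]) : \bar R :=
  'N[mu]_+oo [((fun z => (Normc.normc (f z))%:E) \_ D)]%E.

Definition in_Loo {d} {T : measurableType d} {R : realType}
    (mu : {measure set T -> \bar R}) (D : set T) (f : T -> R[i]) : Prop :=
  [/\ measurable_fun D (fun z => complex.Re (f z)),
      measurable_fun D (fun z => complex.Im (f z)) &
      (Loo_norm mu D f < +oo)%E].

(* Main.v *)
Require Import Defs.
From HB Require Import structures.
From mathcomp Require Import all_boot all_order all_algebra.
From mathcomp Require Import all_classical all_reals all_analysis.
From mathcomp Require Import measurable_realfun ess_sup_inf.
From mathcomp Require Import complex ring lra.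
Import Order.TTheory GRing.Theory Num.Theory.
Import numFieldNormedType.Exports.
Local Open Scope classical_set_scope.
Local Open Scope ring_scope.
Set Implicit Arguments.
Unset Strict Implicit.
Unset Printing Implicit Defensive.

(** Write K_n(x, y) for the kernel.  For fixed x it is a C^(k+1) function of y
    away from x, and each derivative in y costs at most a factor n + 1.  Hence
    near any y0 in Y the kernel differs from a polynomial in y - y0 with
    (k + 1)^2 coefficients depending on x by O(((n + 1) |y - y0|)^(k+1)),
    uniformly in x, y0 and n ([kernel_n_expansion]).  Cut a square containing Y
    into L^2 squares of side h ~ eps^(1/(k+1)) / (n + 1) and use on each of them
    the polynomial centred at one of its points: the error is O(eps), and every
    monomial times the indicator of its square is a separable term.  The number
    of terms is (k + 1)^2 L^2 = O((n + 1)^2 eps^(-2/(k+1))), which is within the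
    claimed bound because n + 1 <= n + |ln eps| for eps < 1/e
    ([low_rank_approximation]).

    The uniform smoothness is obtained without computing higher derivatives.
    A family of functions on boxes is called smooth of order m when it is
    uniformly bounded and its partial derivatives are nu times families smooth
    of order m - 1, where nu is a weight attached to the parameter; here
    nu = n + 1.  Such families form an algebra and have Taylor expansions
    ([smooth_family_taylor]).  Each factor of the kernel has first derivatives
    expressible through the factor itself, so that smoothness of order m gives
    order m + 1:
      - d(1/r) = (x - y) (1/r)^3 dy for r = |x - y|;
      - d cos(n theta) = - n sin(n theta) d theta, and likewise for the sine;
      - d exp(- F) = - exp(- F) dF.
    The optical depth is r times the integral of sigma_t along the segment; the
    derivative of the moment of order j of phi along the segment is the moment
    of order j + 1 of a derivative of phi ([smooth_segment_moment]).

    The coefficients of the expansions are functions of x whose measurability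
    is not immediate.  They are therefore replaced by their values at nodes of a
    partition of X; its mesh can be as small as desired since it does not enter
    the number of terms.  The error made is controlled by the Lipschitz
    continuity of K_n in x, which follows from the expansion in y with X and Y
    exchanged, because K_n(y, x) = (-1)^n K_n(x, y) ([kernel_n_sym]). *)

(** * Mean value estimates in one variable *)

Section MeanValue.
Variable R : realType.
Implicit Types (f : R -> R) (b M : R).

Lemma norm_increment_le f (f' : R -> R) b M :
  (forall t : R, `|t| <= `|b| -> is_derive t 1 f (f' t)) ->
  (forall t : R, `|t| <= `|b| -> `|f' t| <= M) ->
  `|f b - f 0| <= M * `|b|.
Proof.
move=> df f'M.
have cont (x y : R) : `|x| <= `|b| -> `|y| <= `|b| ->
    {within `[x, y], continuous f}.
  move=> xb yb; apply: derivable_within_continuous => t.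
  rewrite in_itv/= => /andP[xt ty].
  have := df t; case => //; rewrite ler_norml.
  move: xb yb; rewrite !ler_norml => /andP[? ?] /andP[? ?].
  by rewrite (le_trans _ xt)//= (le_trans ty).
have [b0|b0] := leP 0 b.
- have [||c] := @MVT_segment R f f' 0 b b0.
  + move=> t; rewrite in_itv/= => /andP[/ltW t0 /ltW tb]; apply: df.
    by rewrite !ger0_norm.
  + by apply: cont; rewrite ?normr0.
  + rewrite in_itv/= => /andP[c0 cb] ->; rewrite subr0 normrM.
    by rewrite ler_wpM2r// f'M// !ger0_norm.
- have [||c] := @MVT_segment R f f' b 0 (ltW b0).
  + move=> t; rewrite in_itv/= => /andP[/ltW bt /ltW t0]; apply: df.
    by rewrite !ler0_norm ?lerN2// ltW.
  + by apply: cont; rewrite ?normr0.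
  + rewrite in_itv/= => /andP[bc c0] E; rewrite distrC E sub0r normrM normrN.
    by rewrite ler_wpM2r// f'M// !ler0_norm ?lerN2// ltW.
Qed.

Lemma is_derive_translate f (q t d : R) :
  is_derive (q + t) (1 : R) f d -> is_derive t (1 : R) (fun s => f (q + s)) d.
Proof.
move=> df; have dq : is_derive t (1 : R) (fun s : R => q + s) 1.
  by apply: is_derive_eq (is_deriveD (is_derive_cst q t 1) (is_derive_id t 1)) _; rewrite add0r.
by apply: is_derive_eq (is_derive1_comp df dq) _; rewrite mulr1.
Qed.

(** An approximation of the derivative by a polynomial integrates to an
    approximation of the function, with one more power of the increment; the
    mean value theorem is applied to the difference with the primitive. *)
Lemma antiderivative_error f (f' : R -> R) q b M (m : nat) (d : nat -> R) :
  (forall t : R, `|t| <= `|b| -> is_derive (q + t) 1 f (f' t)) ->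
  (forall t : R, `|t| <= `|b| -> `|f' t - \sum_(l < m) d l * t ^+ l| <= M) ->
  `|f (q + b) - f q - \sum_(l < m) d l / l.+1%:R * b ^+ l.+1| <= M * `|b|.
Proof.
move=> df f'M.
(* P is the primitive of the given polynomial that vanishes at 0. *)
pose fq t := f (q + t).
pose P (t : R) := \sum_(l < m) d l / l.+1%:R * t ^+ l.+1.
have dP (t : R) : is_derive t 1 P (\sum_(l < m) d l * t ^+ l).
  have -> : P = \sum_(l < m) (fun t : R => d l / l.+1%:R * t ^+ l.+1).
    by apply/funext => s; rewrite fct_sumE.
  apply: is_derive_sum => l.
  have -> : (fun t : R => d l / l.+1%:R * t ^+ l.+1) = (d l / l.+1%:R) \*: ((@id R) ^+ l.+1).
    by apply/funext => s; rewrite /GRing.scale/= exprfctE.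
  apply: is_derive_eq.
  rewrite /GRing.scale/= mulr1 mulrA divfK ?pnatr_eq0//.
have -> : f (q + b) - f q - \sum_(l < m) d l / l.+1%:R * b ^+ l.+1 =
    (fq - P) b - (fq - P) 0.
  rewrite -/(P b) !fctE /fq addr0 [P 0]big1 ?subr0 1?addrAC// => l _.
  by rewrite expr0n/= mulr0.
apply: (@norm_increment_le _ (fun t => f' t - \sum_(l < m) d l * t ^+ l)) => //.
by move=> t /df /is_derive_translate dft; apply: is_deriveB.
Qed.
End MeanValue.

(** * Families of functions with uniform Taylor expansions *)

Section BivariatePolynomials.
Variable R : realType.

(** The bound m is on each of the two degrees, so that a polynomial costs m^2
    separable terms. *)
Definition poly2 (m : nat) (P : R -> R -> R) := exists c : nat -> nat -> R,
  forall a b, P a b = \sum_(k < m) \sum_(l < m) c k l * a ^+ k * b ^+ l.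

Lemma poly2D m P Q : poly2 m P -> poly2 m Q ->
  poly2 m (fun a b => P a b + Q a b).
Proof.
move=> [c Pc] [d Qd]; exists (fun k l => c k l + d k l) => a b.
rewrite Pc Qd -big_split; apply: eq_bigr => k _ /=.
by rewrite -big_split; apply: eq_bigr => l _ /=; rewrite !mulrDl.
Qed.

Lemma poly2_sum m n (P : nat -> R -> R -> R) :
  (forall j, (j < n)%N -> poly2 m (P j)) ->
  poly2 m (fun a b => \sum_(j < n) P j a b).
Proof.
elim: n => [|n IH] Pm.
  exists (fun _ _ => 0) => a b; rewrite big_ord0 big1// => k _.
  by rewrite big1// => l _; rewrite !mul0r.
have [c Hc] : poly2 m (fun a b => \sum_(j < n) P j a b + P n a b).
  by apply: poly2D; [apply: IH => j jn; apply: Pm; exact: ltnW|exact: Pm].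
by exists c => a b; rewrite big_ord_recr/= Hc.
Qed.

Lemma poly2_monomial m x k l : (k < m)%N -> (l < m)%N ->
  poly2 m (fun a b => x * a ^+ k * b ^+ l).
Proof.
move=> km lm; exists (fun k' l' => if (k' == k) && (l' == l) then x else 0) => a b.
rewrite (bigD1 (Ordinal km))//= (bigD1 (Ordinal lm))//= !eqxx/=.
rewrite big1 ?addr0 => [|l' ll']; last first.
  rewrite ifF ?mul0r//; apply/negbTE; move: ll'; apply: contra.
  by move=> /eqP E; apply/eqP/val_inj.
rewrite big1 ?addr0// => k' kk'; rewrite big1// => l' _.
rewrite ifF ?mul0r//; apply/negbTE; rewrite negb_and; apply/orP; left.
by move: kk'; apply: contra => /eqP E; apply/eqP/val_inj.
Qed.

End BivariatePolynomials.

Section SmoothFamilies.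
Variables (R : realType) (I : Type) (D : I -> Prop) (p : I -> R * R).
Variables (delta : R) (nu : I -> R).

(** The box is empty when the parameter i is not admissible; this lets I be a
    plain type while all estimates are uniform over D only. *)
Definition in_box (i : I) (a b : R) :=
  [/\ D i, `|a - (p i).1| < delta & `|b - (p i).2| < delta].

Definition bounded_family (F : I -> R -> R -> R) :=
  exists M, forall i a b, in_box i a b -> `|F i a b| <= M.

Definition partials (F G1 G2 : I -> R -> R -> R) :=
  forall i a b, in_box i a b ->
    is_derive a (1 : R) (F i ^~ b) (nu i * G1 i a b) /\
    is_derive b (1 : R) (F i a) (nu i * G2 i a b).

(** The weight nu i records the size of a derivative, so that the bounds on the
    partial derivatives of order j are of the form M (nu i)^j with M
    independent of i. *)
Fixpoint smooth_family (m : nat) (F : I -> R -> R -> R) : Prop :=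
  bounded_family F /\
  match m with
  | 0 => True
  | m'.+1 => exists G1 G2,
      [/\ partials F G1 G2, smooth_family m' G1 & smooth_family m' G2]
  end.

Lemma smooth_family_bounded m F : smooth_family m F -> bounded_family F.
Proof. by case: m => [|m] []. Qed.

Lemma smooth_familyW m F : smooth_family m.+1 F -> smooth_family m F.
Proof.
elim: m F => [|m IH] F [bF [G1 [G2 [dF G1m G2m]]]]; split=> //.
by exists G1, G2; split => //; exact: IH.
Qed.

Hypothesis nu_ge0 : forall i, D i -> 0 <= nu i.

(** Induction on m.  From the centre go first along the horizontal axis and then
    vertically: on each leg the expansion of one partial derivative, known to
    order m, is integrated.  Both partials are expanded at the same centre, so
    that the two legs give polynomials in the same increments a and b. *)
Lemma smooth_family_taylor m F : smooth_family m F ->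
  exists2 C : R, 0 <= C & forall i, D i -> exists2 P, poly2 m P &
    forall h a b, h < delta -> `|a| <= h -> `|b| <= h ->
      `|F i ((p i).1 + a) ((p i).2 + b) - P a b| <= C * (nu i * h) ^+ m.
Proof.
elim: m F => [|m IH] F.
  move=> [[M FM] _]; exists `|M| => // i Di; exists (fun _ _ => 0).
    by exists (fun _ _ => 0) => a b; rewrite big_ord0.
  move=> h a b hd ah bh; rewrite subr0 expr0 mulr1.
  apply: le_trans (ler_norm M); apply: FM; split=> //;
    by rewrite addrAC subrr add0r (le_lt_trans _ hd).
move=> [_ [G1 [G2 [dF /IH [C1 C10 T1] /IH [C2 C20 T2]]]]].
exists (C1 + C2) => [|i Di]; first exact: addr_ge0.
have [P1 [c1 P1E] G1P] := T1 i Di; have [P2 [c2 P2E] G2P] := T2 i Di.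
set p1 := (p i).1; set p2 := (p i).2.
have box a b : `|a| < delta -> `|b| < delta -> in_box i (p1 + a) (p2 + b).
  by move=> ad bd; split=> //; rewrite addrAC subrr add0r.
pose d1 k := nu i * c1 k 0%N.
pose d2 a l := nu i * \sum_(k < m) c2 k l * a ^+ k.
exists (fun a b => F i p1 p2 + \sum_(k < m) d1 k / k.+1%:R * a ^+ k.+1 +
                   \sum_(l < m) d2 a l / l.+1%:R * b ^+ l.+1).
  have cst : poly2 m.+1 (fun _ _ => F i p1 p2).
    have [c E] := poly2_monomial (F i p1 p2) (ltn0Sn m) (ltn0Sn m).
    by exists c => a b; rewrite -E !expr0 !mulr1.
  apply: poly2D; first apply: poly2D => //.
    apply: (@poly2_sum _ _ _ (fun k a b => d1 k / k.+1%:R * a ^+ k.+1)) => k km.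
    have [c E] := @poly2_monomial R m.+1 (d1 k / k.+1%:R) k.+1 0 km isT.
    by exists c => a b; rewrite -E expr0 mulr1.
  apply: (@poly2_sum _ _ _ (fun l a b => d2 a l / l.+1%:R * b ^+ l.+1)) => l lm.
  have [c E] : poly2 m.+1 (fun a b => \sum_(k < m)
      nu i * c2 k l / l.+1%:R * a ^+ k * b ^+ l.+1).
    apply: (@poly2_sum _ _ _ (fun k a b => nu i * c2 k l / l.+1%:R * a ^+ k * b ^+ l.+1)) => k km.
    by apply: poly2_monomial => //; exact: ltnW.
  exists c => a b; rewrite -E /d2 mulr_sumr !mulr_suml; apply: eq_bigr => k _.
  by ring.
move=> h a b hd ah bh.
have h0 : 0 <= h by exact: le_trans ah.
have nuh0 : 0 <= nu i * h by rewrite mulr_ge0 ?nu_ge0.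
have small (t c : R) : `|c| <= h -> `|t| <= `|c| -> `|t| < delta.
  by move=> ch tc; rewrite (le_lt_trans tc)// (le_lt_trans ch).
have scale (x : R) C E : 0 <= C -> `|x| <= h -> E <= nu i * (C * (nu i * h) ^+ m) * `|x| ->
    E <= C * (nu i * h) ^+ m.+1.
  move=> C0 xh /le_trans; apply; rewrite exprS.
  have K0 : 0 <= (nu i * h) ^+ m by rewrite exprn_ge0.
  move: (_ ^+ m) K0 => K K0.
  rewrite (_ : _ * `|x| = C * K * (nu i * `|x|)); last by ring.
  rewrite [leRHS](_ : _ = C * K * (nu i * h)); last by ring.
  by rewrite ler_wpM2l ?mulr_ge0// ler_wpM2l// nu_ge0.
have leg1 : `|F i (p1 + a) p2 - F i p1 p2 - \sum_(k < m) d1 k / k.+1%:R * a ^+ k.+1|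
    <= C1 * (nu i * h) ^+ m.+1.
  apply: (scale a) => //.
  apply: (@antiderivative_error R (fun s => F i s p2) (fun t => nu i * G1 i (p1 + t) p2)).
  - move=> t ta; have [|//] := dF i (p1 + t) p2.
    by rewrite -[p2]addr0; apply: box; rewrite (small _ a)// normr0.
  - move=> t ta.
    have -> : \sum_(l < m) d1 l * t ^+ l = nu i * P1 t 0.
      rewrite P1E mulr_sumr; apply: eq_bigr => l _.
      rewrite (bigD1 (Ordinal (leq_ltn_trans (leq0n l) (ltn_ord l))))//= big1.
        by rewrite addr0 expr0 mulr1 mulrA.
      by move=> j j0; rewrite expr0n -lt0n in j0 *; rewrite gtn_eqF ?mulr0.
    rewrite -mulrBr normrM ger0_norm ?nu_ge0// ler_wpM2l ?nu_ge0//.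
    rewrite -[p2]addr0; apply: G1P => //; last by rewrite normr0.
    exact: le_trans ah.
have leg2 : `|F i (p1 + a) (p2 + b) - F i (p1 + a) p2 -
    \sum_(l < m) d2 a l / l.+1%:R * b ^+ l.+1| <= C2 * (nu i * h) ^+ m.+1.
  apply: (scale b) => //.
  apply: (@antiderivative_error R (F i (p1 + a)) (fun t => nu i * G2 i (p1 + a) (p2 + t))).
  - move=> t tb; have [|//] := dF i (p1 + a) (p2 + t).
    by apply: box; [exact: small ah _|exact: small tb].
  - move=> t tb.
    have -> : \sum_(l < m) d2 a l * t ^+ l = nu i * P2 a t.
      rewrite P2E exchange_big mulr_sumr; apply: eq_bigr => l _ /=.
      by rewrite /d2 -mulrA mulr_suml.
    rewrite -mulrBr normrM ger0_norm ?nu_ge0// ler_wpM2l ?nu_ge0//.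
    by apply: G2P => //; exact: le_trans bh.
rewrite mulrDl; apply: le_trans (lerD leg1 leg2).
apply: le_trans (ler_normD _ _); rewrite le_eqVlt; apply/orP; left.
by apply/eqP; congr `|_|; ring.
Qed.

Lemma smooth_family_cst m (c : I -> R) :
  (exists M, forall i, D i -> `|c i| <= M) -> smooth_family m (fun i _ _ => c i).
Proof.
elim: m c => [|m IH] c [M cM]; split=> //;
  try by exists M => i a b [Di _ _]; exact: cM.
exists (fun _ _ _ => 0), (fun _ _ _ => 0); split.
- by move=> i a b _; rewrite mulr0; split; exact: is_derive_cst.
- by apply: IH; exists 0 => i _; rewrite normr0.
- by apply: IH; exists 0 => i _; rewrite normr0.
Qed.

Lemma smooth_familyD m F G : smooth_family m F -> smooth_family m G ->
  smooth_family m (fun i a b => F i a b + G i a b).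
Proof.
have bD F' G' : bounded_family F' -> bounded_family G' ->
    bounded_family (fun i a b => F' i a b + G' i a b).
  move=> [M FM] [N GN]; exists (M + N) => i a b iab.
  by rewrite (le_trans (ler_normD _ _))// lerD ?FM ?GN.
elim: m F G => [|m IH] F G [bF sF] [bG sG]; split=> //; try exact: bD.
have [F1 [F2 [dF sF1 sF2]]] := sF; have [G1 [G2 [dG sG1 sG2]]] := sG.
eexists; eexists; split; [|exact: IH sF1 sG1|exact: IH sF2 sG2].
move=> i a b iab; have [dF1 dF2] := dF i a b iab; have [dG1 dG2] := dG i a b iab.
by rewrite !mulrDr; split; exact: is_deriveD.
Qed.

Lemma smooth_familyM m F G : smooth_family m F -> smooth_family m G ->
  smooth_family m (fun i a b => F i a b * G i a b).
Proof.
have bM F' G' : bounded_family F' -> bounded_family G' ->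
    bounded_family (fun i a b => F' i a b * G' i a b).
  move=> [M FM] [N GN]; exists (M * N) => i a b iab.
  by rewrite normrM ler_pM ?FM ?GN.
elim: m F G => [|m IH] F G sF sG; have bF := smooth_family_bounded sF;
  have bG := smooth_family_bounded sG; split=> //; try exact: bM.
have [_ [F1 [F2 [dF sF1 sF2]]]] := sF; have [_ [G1 [G2 [dG sG1 sG2]]]] := sG.
have sF' := smooth_familyW sF; have sG' := smooth_familyW sG.
exists (fun i a b => F i a b * G1 i a b + G i a b * F1 i a b),
  (fun i a b => F i a b * G2 i a b + G i a b * F2 i a b); split.
- move=> i a b iab; have [dF1 dF2] := dF i a b iab; have [dG1 dG2] := dG i a b iab.
  by split; apply: is_derive_eq (is_deriveM _ _) _; rewrite /GRing.scale/=; ring.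
- by apply: smooth_familyD; exact: IH.
- by apply: smooth_familyD; exact: IH.
Qed.

Lemma smooth_familyZ m (c : I -> R) F : (exists M, forall i, D i -> `|c i| <= M) ->
  smooth_family m F -> smooth_family m (fun i a b => c i * F i a b).
Proof. by move=> cM; apply: smooth_familyM; exact: smooth_family_cst. Qed.

Lemma smooth_familyX m n F : smooth_family m F ->
  smooth_family m (fun i a b => F i a b ^+ n).
Proof.
move=> sF; elim: n => [|n IH].
  apply: (smooth_family_cst _ (c := fun=> 1)).
  by exists 1 => i _; rewrite normr1.
by under eq_fun do under eq_fun do under eq_fun do rewrite exprS; exact: smooth_familyM.
Qed.

Hypothesis nu_ge1 : forall i, D i -> 1 <= nu i.

(** Since nu >= 1, derivatives that are bounded without any weight are also
    admissible after division by nu. *)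
Lemma smooth_familyS m F G1 G2 : bounded_family F ->
  (forall i a b, in_box i a b -> is_derive a (1 : R) (F i ^~ b) (G1 i a b) /\
                                 is_derive b (1 : R) (F i a) (G2 i a b)) ->
  smooth_family m G1 -> smooth_family m G2 -> smooth_family m.+1 F.
Proof.
move=> bF dF sG1 sG2; split=> //.
have bnu : exists M, forall i, D i -> `|(nu i)^-1| <= M.
  exists 1 => i Di; have n1 := nu_ge1 Di; have n0 := lt_le_trans ltr01 n1.
  rewrite ger0_norm ?invr_ge0 ?(ltW n0)//.
  by rewrite invf_le1.
exists (fun i a b => (nu i)^-1 * G1 i a b), (fun i a b => (nu i)^-1 * G2 i a b).
split; [|exact: smooth_familyZ|exact: smooth_familyZ].
move=> i a b iab; have [Di _ _] := iab.
by rewrite !mulVKf ?gt_eqF ?(lt_le_trans ltr01) ?nu_ge1//; exact: dF.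
Qed.
End SmoothFamilies.

(** * Distance and polar angle *)

Section MultipleAngles.
Variable R : realType.

(** The pair (cos (n t), sin (n t)) as polynomials in c = cos t and s = sin t.
    In this form it is a smooth function of the point, whereas the principal
    argument jumps across the negative real axis. *)
Fixpoint multiple_angle (n : nat) (c s : R) : R * R :=
  if n is n'.+1 then
    let: (u, v) := multiple_angle n' c s in (u * c - v * s, u * s + v * c)
  else (1, 0).

Lemma multiple_angleE n t :
  multiple_angle n (cos t) (sin t) = (cos (n%:R * t), sin (n%:R * t)).
Proof.
elim: n => [|n /= ->]; first by rewrite mul0r cos0 sin0.
by rewrite -natr1 mulrDl mul1r cosD sinD; congr pair; ring.
Qed.

Lemma multiple_angle_opp n c s : multiple_angle n (- c) (- s) =
  ((-1) ^+ n * (multiple_angle n c s).1, (-1) ^+ n * (multiple_angle n c s).2).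
Proof.
elim: n => [|n /= ->]; first by rewrite expr0 mul1r mulr0.
by case: multiple_angle => u v /=; rewrite exprS; congr pair; ring.
Qed.

Lemma multiple_angle_sqr n c s : c ^+ 2 + s ^+ 2 = 1 ->
  (multiple_angle n c s).1 ^+ 2 + (multiple_angle n c s).2 ^+ 2 = 1.
Proof.
move=> cs; elim: n => [|n /=]; first by rewrite expr1n expr0n addr0.
by case: multiple_angle => u v /= uv; rewrite -[RHS]mul1r -{1}uv -cs; ring.
Qed.

(** Here w is the derivative of the angle: the hypotheses say that (c, s) turns
    with angular velocity w, hence (cos (n t), sin (n t)) turns with velocity
    n w. *)
Lemma is_derive_multiple_angle n (c s : R -> R) (a w : R) :
  is_derive a (1 : R) c (- w * s a) -> is_derive a (1 : R) s (w * c a) ->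
  is_derive a (1 : R) (fun t => (multiple_angle n (c t) (s t)).1)
    (- (n%:R * w) * (multiple_angle n (c a) (s a)).2) /\
  is_derive a (1 : R) (fun t => (multiple_angle n (c t) (s t)).2)
    (n%:R * w * (multiple_angle n (c a) (s a)).1).
Proof.
move=> dc ds; elim: n => [|n [du dv]].
  by rewrite !mul0r oppr0 mul0r; split; exact: is_derive_cst.
pose u t := (multiple_angle n (c t) (s t)).1.
pose v t := (multiple_angle n (c t) (s t)).2.
have E t : multiple_angle n.+1 (c t) (s t) =
    (u t * c t - v t * s t, u t * s t + v t * c t).
  by rewrite /u /v /=; case: multiple_angle.
split; under eq_fun do rewrite E; rewrite E /= -natr1.
  apply: is_derive_eq (is_deriveB (is_deriveM du dc) (is_deriveM dv ds)) _.
  by rewrite -/(u a) -/(v a) /GRing.scale/=; ring.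
apply: is_derive_eq (is_deriveD (is_deriveM du ds) (is_deriveM dv dc)) _.
by rewrite -/(u a) -/(v a) /GRing.scale/=; ring.
Qed.

Lemma enorm_gt0 (z : R * R) : z != 0 -> 0 < enorm z.
Proof.
case: z => a b ab0; rewrite /enorm sqrtr_gt0/= lt0r addr_ge0 ?sqr_ge0// andbT.
by rewrite paddr_eq0 ?sqr_ge0// !sqrf_eq0; move: ab0; rewrite xpair_eqE.
Qed.

(** The branch of the arc cosine chosen in [parg] is the one with the right sign
    of the sine. *)
Lemma cos_sin_parg (z : R * R) : z != 0 ->
  cos (parg z) = z.1 / enorm z /\ sin (parg z) = z.2 / enorm z.
Proof.
move=> /enorm_gt0 r0; set r := enorm z in r0 *.
have rE : z.1 ^+ 2 + z.2 ^+ 2 = r ^+ 2.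
  by rewrite /r sqr_sqrtr// addr_ge0 ?sqr_ge0.
have zr : -1 <= z.1 / r <= 1.
  rewrite -ler_norml normrM normfV (gtr0_norm r0) ler_pdivrMr// mul1r.
  by rewrite -(gtr0_norm r0) -ler_sqr ?nnegrE// !real_normK ?num_real// -rE lerDl sqr_ge0.
have sE : sin (acos (z.1 / r)) = `|z.2| / r.
  rewrite sin_acos// -[RHS]ger0_norm ?divr_ge0 ?(ltW r0)// -sqrtr_sqr.
  congr Num.sqrt; rewrite !expr_div_n real_normK ?num_real// -(divff (x := r ^+ 2)).
    by rewrite -mulrBl -rE addrAC subrr add0r.
  by rewrite expf_neq0// gt_eqF.
rewrite /parg -/r; case: (leP 0 z.2) => z20.
  by rewrite acosK ?in_itv//= sE ger0_norm.
by rewrite cosN sinN acosK ?in_itv//= sE ltr0_norm// mulNr opprK.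
Qed.
End MultipleAngles.

Section InverseDistance.
Variable R : realType.

Lemma is_derive_inv_dist (u v a : R) : 0 < (u - a) ^+ 2 + v ^+ 2 ->
  is_derive a (1 : R) (fun t => (Num.sqrt ((u - t) ^+ 2 + v ^+ 2))^-1)
    ((u - a) * (Num.sqrt ((u - a) ^+ 2 + v ^+ 2))^-1 ^+ 3).
Proof.
move=> r0; pose q t : R := (u - t) ^+ 2 + v ^+ 2.
have dq : is_derive a (1 : R) q (- 2 * (u - a)).
  have d1 : is_derive a (1 : R) (cst u - id : R -> R) (- 1).
    by apply: is_derive_eq; rewrite sub0r.
  apply: (@is_derive_eq _ _ _ ((cst u - id) ^+ 2 + cst (v ^+ 2)) _ _ _ _
    (is_deriveD (is_deriveX 2 d1) (is_derive_cst _ _ _))).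
  by rewrite /GRing.scale/= addr0 expr1 !fctE/=; ring.
have s0 : Num.sqrt (q a) != 0 by rewrite sqrtr_eq0 -ltNge.
have ds := @is_derive1_comp R Num.sqrt q a _ _ (is_derive1_sqrt r0) dq.
have D := @is_deriveV _ (Num.sqrt \o q) a _ 1 s0 ds; refine (is_derive_eq D _).
rewrite /= /GRing.scale/=.
by move: s0; rewrite -/(q a); move: (Num.sqrt (q a)) => r s0; field.
Qed.
End InverseDistance.

Section PolarFamilies.
Variables (R : realType) (I : Type) (D : I -> Prop) (p x : I -> R * R).
Variables (n : I -> nat) (delta B r0 : R).
Let nu i : R := (n i).+1%:R.

Local Notation box := (in_box D p delta).
Local Notation smooth := (smooth_family D p delta nu).

Hypothesis near_x : forall i a b, box i a b ->
  `|(x i).1 - a| <= B /\ `|(x i).2 - b| <= B.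
Hypothesis r0_gt0 : 0 < r0.
Hypothesis far_x : forall i a b, box i a b -> r0 <= enorm (x i - (a, b)).

Let nu_ge1 i : D i -> 1 <= nu i.
Proof. by rewrite /nu ler1n. Qed.

Let z1 i a (b : R) : R := (x i).1 - a.
Let z2 i (a : R) b : R := (x i).2 - b.
Let rinv i a b : R := (enorm (x i - (a, b)))^-1.

(** The factor n produced by differentiating cos (n theta) is absorbed by the
    weight n + 1. *)
Lemma bounded_frequency : exists M, forall i, D i -> `|(n i)%:R / nu i| <= M.
Proof.
exists 1 => i _; rewrite ger0_norm ?divr_ge0//.
by rewrite ler_pdivrMr ?ltr0n// mul1r ler_nat.
Qed.

Lemma smooth_difference1 m : smooth m z1.
Proof.
case: m => [|m].
  by split=> //; exists B => i a b /near_x[].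
apply: (smooth_familyS nu_ge1 (G1 := fun _ _ _ => -1) (G2 := fun _ _ _ => 0)).
- by exists B => i a b /near_x[].
- move=> i a b _; split; last exact: is_derive_cst.
  by apply: is_derive_eq (is_deriveB (is_derive_cst _ _ _) (is_derive_id _ _)) _; rewrite sub0r.
- by apply: (smooth_family_cst _ _ _ _ (c := fun=> -1)); exists 1 => i _; rewrite normrN1.
- by apply: (smooth_family_cst _ _ _ _ (c := fun=> 0)); exists 1 => i _; rewrite normr0.
Qed.

Lemma smooth_difference2 m : smooth m z2.
Proof.
case: m => [|m].
  by split=> //; exists B => i a b /near_x[].
apply: (smooth_familyS nu_ge1 (G1 := fun _ _ _ => 0) (G2 := fun _ _ _ => -1)).
- by exists B => i a b /near_x[].
- move=> i a b _; split; first exact: is_derive_cst.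
  by apply: is_derive_eq (is_deriveB (is_derive_cst _ _ _) (is_derive_id _ _)) _; rewrite sub0r.
- by apply: (smooth_family_cst _ _ _ _ (c := fun=> 0)); exists 1 => i _; rewrite normr0.
- by apply: (smooth_family_cst _ _ _ _ (c := fun=> -1)); exists 1 => i _; rewrite normrN1.
Qed.

Let dist_gt0 i a b : box i a b -> 0 < enorm (x i - (a, b)).
Proof. by move/far_x; exact: lt_le_trans. Qed.

Let is_derive_rinv i a b : box i a b ->
  is_derive a (1 : R) (rinv i ^~ b) (z1 i a b * rinv i a b ^+ 3) /\
  is_derive b (1 : R) (rinv i a) (z2 i a b * rinv i a b ^+ 3).
Proof.
move=> /dist_gt0; rewrite /enorm sqrtr_gt0/= => r_gt0; split.
  exact: (@is_derive_inv_dist R (x i).1 ((x i).2 - b) a r_gt0).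
have E t : rinv i a t = (Num.sqrt (((x i).2 - t) ^+ 2 + ((x i).1 - a) ^+ 2))^-1.
  by rewrite /rinv /enorm/= addrC.
rewrite E [X in is_derive _ _ X _](funext E).
by apply: (@is_derive_inv_dist R (x i).2 ((x i).1 - a) b); rewrite addrC.
Qed.

(** The derivative of 1/r is (x - y) (1/r)^3, a polynomial in functions already
    smooth to the previous order. *)
Lemma smooth_inv_dist m : smooth m rinv.
Proof.
have bounded : bounded_family D p delta rinv.
  exists r0^-1 => i a b iab; have r_gt0 := dist_gt0 iab.
  by rewrite ger0_norm ?invr_ge0 ?(ltW r_gt0)// lef_pV2 ?posrE// far_x.
elim: m => [//|m IH].
by apply: (smooth_familyS nu_ge1 bounded is_derive_rinv);
  apply: smooth_familyM; [exact: smooth_difference1| |exact: smooth_difference2|];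
  exact: smooth_familyX.
Qed.

Lemma smooth_dist m : smooth m (fun i a b => enorm (x i - (a, b))).
Proof.
have E : (fun i a b => enorm (x i - (a, b))) =
    (fun i a b => (z1 i a b * z1 i a b + z2 i a b * z2 i a b) * rinv i a b).
  apply/funext => i; apply/funext => a; apply/funext => b.
  rewrite /z1 /z2 -!expr2 /rinv.
  have -> : ((x i).1 - a) ^+ 2 + ((x i).2 - b) ^+ 2 = enorm (x i - (a, b)) ^+ 2.
    by rewrite sqr_sqrtr ?addr_ge0 ?sqr_ge0.
  have [->|r0'] := eqVneq (enorm (x i - (a, b))) 0; first by rewrite invr0 mulr0.
  by rewrite expr2 mulfK.
rewrite E; apply: smooth_familyM; last exact: smooth_inv_dist.
by apply: smooth_familyD; apply: smooth_familyM;
  do ?[exact: smooth_difference1|exact: smooth_difference2].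
Qed.

Let angle i a b :=
  multiple_angle (n i) (z1 i a b * rinv i a b) (z2 i a b * rinv i a b).

(** Sine and cosine are treated together because each derivative exchanges
    them; only here does a derivative really cost the factor n. *)
Lemma smooth_multiple_angle m :
  smooth m (fun i a b => (angle i a b).1) /\ smooth m (fun i a b => (angle i a b).2).
Proof.
have unit i a b : box i a b ->
    (z1 i a b * rinv i a b) ^+ 2 + (z2 i a b * rinv i a b) ^+ 2 = 1.
  move=> /dist_gt0 r_gt0; rewrite !exprMn -mulrDl /rinv exprVn.
  rewrite -[X in X / _](_ : enorm (x i - (a, b)) ^+ 2 = _) ?divff ?expf_neq0 ?gt_eqF//.
  by rewrite sqr_sqrtr ?addr_ge0 ?sqr_ge0.
have cs1 i a b : box i a b -> (angle i a b).1 ^+ 2 + (angle i a b).2 ^+ 2 = 1.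
  by move=> /unit; exact: multiple_angle_sqr.
have b1 : bounded_family D p delta (fun i a b => (angle i a b).1).
  exists 1 => i a b /cs1 E; rewrite -ler_sqr ?nnegrE// expr1n real_normK ?num_real//.
  by rewrite -E lerDl sqr_ge0.
have b2 : bounded_family D p delta (fun i a b => (angle i a b).2).
  exists 1 => i a b /cs1 E; rewrite -ler_sqr ?nnegrE// expr1n real_normK ?num_real//.
  by rewrite -E lerDr sqr_ge0.
pose w1 i a b := z2 i a b * rinv i a b ^+ 2.
pose w2 i a b := - (z1 i a b * rinv i a b ^+ 2).
have sw1 m' : smooth m' w1.
  by apply: smooth_familyM; [exact: smooth_difference2|exact/smooth_familyX/smooth_inv_dist].
have sw2 m' : smooth m' w2.
  rewrite (_ : w2 = (fun i a b => -1 * (z1 i a b * rinv i a b ^+ 2))); last first.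
    by apply/funext => i; apply/funext => a; apply/funext => b; rewrite mulN1r.
  apply: smooth_familyM.
    by apply: (smooth_family_cst _ _ _ _ (c := fun=> -1)); exists 1 => i _; rewrite normrN1.
  by apply: smooth_familyM; [exact: smooth_difference1|exact/smooth_familyX/smooth_inv_dist].
have d1 i a b : box i a b ->
    is_derive a (1 : R) (fun t => (angle i t b).1) (- ((n i)%:R * w1 i a b) * (angle i a b).2) /\
    is_derive a (1 : R) (fun t => (angle i t b).2) ((n i)%:R * w1 i a b * (angle i a b).1).
  move=> iab; have [dr _] := is_derive_rinv iab; have E := unit _ _ _ iab.
  have dz1 : is_derive a (1 : R) (z1 i ^~ b) (-1).
    by apply: is_derive_eq (is_deriveB (is_derive_cst _ _ _) (is_derive_id _ _)) _; rewrite sub0r.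
  have dz2 : is_derive a (1 : R) (z2 i ^~ b) 0 by exact: is_derive_cst.
  apply: (is_derive_multiple_angle (n i) (c := fun t => z1 i t b * rinv i t b)
    (s := fun t => z2 i t b * rinv i t b)).
  - apply: is_derive_eq (is_deriveM dz1 dr) _; rewrite /GRing.scale/= /w1.
    rewrite mulrN1 -[X in _ - X]mulr1 -E; ring.
  - by apply: is_derive_eq (is_deriveM dz2 dr) _; rewrite /GRing.scale/= /w1; ring.
have d2 i a b : box i a b ->
    is_derive b (1 : R) (fun t => (angle i a t).1) (- ((n i)%:R * w2 i a b) * (angle i a b).2) /\
    is_derive b (1 : R) (fun t => (angle i a t).2) ((n i)%:R * w2 i a b * (angle i a b).1).
  move=> iab; have [_ dr] := is_derive_rinv iab; have E := unit _ _ _ iab.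
  have dz2 : is_derive b (1 : R) (z2 i a) (-1).
    by apply: is_derive_eq (is_deriveB (is_derive_cst _ _ _) (is_derive_id _ _)) _; rewrite sub0r.
  have dz1 : is_derive b (1 : R) (z1 i a) 0 by exact: is_derive_cst.
  apply: (is_derive_multiple_angle (n i) (c := fun t => z1 i a t * rinv i a t)
    (s := fun t => z2 i a t * rinv i a t)).
  - by apply: is_derive_eq (is_deriveM dz1 dr) _; rewrite /GRing.scale/= /w2; ring.
  - apply: is_derive_eq (is_deriveM dz2 dr) _; rewrite /GRing.scale/= /w2.
    rewrite mulrN1 -[X in _ - X]mulr1 -E; ring.
elim: m => [//|m [IH1 IH2]]; have nu0 i : nu i != 0 by rewrite pnatr_eq0.
split; split => //.
- exists (fun i a b => (n i)%:R / nu i * (-1 * (w1 i a b * (angle i a b).2))),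
    (fun i a b => (n i)%:R / nu i * (-1 * (w2 i a b * (angle i a b).2))); split.
  + move=> i a b iab; have [D1 _] := d1 i a b iab; have [D2 _] := d2 i a b iab.
    by split; [apply: is_derive_eq D1 _|apply: is_derive_eq D2 _];
      rewrite -/(nu i) [RHS]mulrA [nu i * _]mulrCA divff//; ring.
  + apply: smooth_familyZ; first exact: bounded_frequency.
    apply: (smooth_familyZ (c := fun=> -1)); last exact: smooth_familyM.
    by exists 1 => i _; rewrite normrN1.
  + apply: smooth_familyZ; first exact: bounded_frequency.
    apply: (smooth_familyZ (c := fun=> -1)); last exact: smooth_familyM.
    by exists 1 => i _; rewrite normrN1.
- exists (fun i a b => (n i)%:R / nu i * (w1 i a b * (angle i a b).1)),
    (fun i a b => (n i)%:R / nu i * (w2 i a b * (angle i a b).1)); split.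
  + move=> i a b iab; have [_ D1] := d1 i a b iab; have [_ D2] := d2 i a b iab.
    by split; [apply: is_derive_eq D1 _|apply: is_derive_eq D2 _];
      rewrite -/(nu i) [RHS]mulrA [nu i * _]mulrCA divff//; ring.
  + by apply: smooth_familyZ; [exact: bounded_frequency|exact: smooth_familyM].
  + by apply: smooth_familyZ; [exact: bounded_frequency|exact: smooth_familyM].
Qed.

(** The derivative of exp (- F) is - F' exp (- F), whose smoothness to order m
    is the induction hypothesis. *)
Lemma smooth_expN m F : smooth m F -> smooth m (fun i a b => expR (- F i a b)).
Proof.
elim: m F => [|m IH] F sF; have [M FM] := smooth_family_bounded sF.
  split=> //; exists (expR M) => i a b iab; rewrite gtr0_norm ?expR_gt0// ler_expR.
  by rewrite (le_trans (ler_norm _))// normrN FM.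
split.
  exists (expR M) => i a b iab; rewrite gtr0_norm ?expR_gt0// ler_expR.
  by rewrite (le_trans (ler_norm _))// normrN FM.
have sE := IH _ (smooth_familyW sF).
have [_ [G1 [G2 [dF sG1 sG2]]]] := sF.
exists (fun i a b => -1 * (G1 i a b * expR (- F i a b))),
  (fun i a b => -1 * (G2 i a b * expR (- F i a b))); split.
- move=> i a b iab; have [dF1 dF2] := dF i a b iab.
  have comp f t d : is_derive t (1 : R) f d ->
      is_derive t (1 : R) (fun s => expR (- f s)) (- d * expR (- f t)).
    move=> df; have dE := @is_derive1_comp R expR (- f) t _ _ (is_derive_expR _) (is_deriveN df).
    by apply: is_derive_eq dE _; rewrite mulrC.
  by split; [apply: is_derive_eq (comp _ _ _ dF1) _|apply: is_derive_eq (comp _ _ _ dF2) _]; ring.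
- by apply: (smooth_familyZ (c := fun=> -1));
    [exists 1 => i _; rewrite normrN1|exact: smooth_familyM].
- by apply: (smooth_familyZ (c := fun=> -1));
    [exists 1 => i _; rewrite normrN1|exact: smooth_familyM].
Qed.
End PolarFamilies.

(** * Integrals along segments of a convex region *)

Section PlaneRegions.
Variables (R : realType) (Omega : set (R * R)).

Lemma bounded_set_box : bounded_set Omega ->
  exists2 B : R, 0 < B & forall x, Omega x -> `|x.1| <= B /\ `|x.2| <= B.
Proof.
move=> [M [_ MO]]; exists (`|M| + 1) => [|x Ox]; first by rewrite ltr_wpDl.
have := MO (`|M| + 1); rewrite (le_lt_trans (ler_norm M)) ?ltrDl// => /(_ isT x Ox).
by rewrite /Num.norm/= ge_max => /andP[].
Qed.

Lemma compact_closure : bounded_set Omega -> compact (closure Omega).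
Proof.
move=> /bounded_set_box[B B0 OB].
apply: (@subclosed_compact _ _ (`[- B, B] `*` `[- B, B])).
- exact: closed_closure.
- by apply: compact_setX; exact: segment_compact.
- have cl : closed (`[- B, B] `*` `[- B, B] : set (R * R)).
    apply: compact_closed; last by apply: compact_setX; exact: segment_compact.
    exact: norm_hausdorff.
  rewrite [X in _ `<=` X](closure_id _).1//; apply: closure_subset.
  by move=> x /OB[? ?]; split; rewrite /= in_itv/= -ler_norml.
Qed.

Lemma continuous_bounded (f : R * R -> R) : bounded_set Omega ->
  {within closure Omega, continuous f} ->
  exists M, forall x, Omega x -> `|f x| <= M.
Proof.
move=> bO cf.
have [M [_ MO]] := compact_bounded (continuous_compact cf (compact_closure bO)).
exists (`|M| + 1) => x Ox; apply: (MO (`|M| + 1)).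
  by rewrite (le_lt_trans (ler_norm M)) ?ltrDl.
by exists x => //; exact: subset_closure.
Qed.

Lemma convex_segment (x y : R * R) (s : R) : convex_set Omega ->
  Omega x -> Omega y -> 0 <= s <= 1 -> Omega (x + s *: (y - x)).
Proof.
move=> cO Ox Oy /andP[s0 s1].
have := cO y x (Itv01 s0 s1); rewrite !inE => /(_ Oy Ox).
congr (Omega _); rewrite /conv/=.
by rewrite /unstable.onem scalerBl scale1r scalerBr addrCA.
Qed.
End PlaneRegions.

Section LineIntegrals.
Variables (R : realType) (Omega : set (R * R)).
Hypotheses (Omega_open : open Omega) (Omega_convex : convex_set Omega).
Hypothesis Omega_bounded : bounded_set Omega.

(** The weights s^j make the family closed under differentiation in y, because
    y enters the integrand through s y. *)
Definition segment_moment (phi : R * R -> R) (j : nat) (x y : R * R) : R :=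
  \int[@lebesgue_measure R]_(s in `[0, 1]) (s ^+ j * phi (x + s *: (y - x))).

Lemma within_closure_continuous_at (phi : R * R -> R) x :
  {within closure Omega, continuous phi} -> Omega x -> {for x, continuous phi}.
Proof.
move=> cphi Ox; have : {within Omega, continuous phi}.
  by apply: continuous_subspaceW cphi; exact: subset_closure.
by rewrite continuous_open_subspace// => /(_ x); apply; rewrite inE.
Qed.

Lemma continuous_along_segment (phi : R * R -> R) x y j :
  {within closure Omega, continuous phi} -> Omega x -> Omega y ->
  {within `[0, 1], continuous (fun s : R => s ^+ j * phi (x + s *: (y - x)))}.
Proof.
move=> cphi Ox Oy; apply: continuous_in_subspaceT => s; rewrite inE/= in_itv/= => s01.
apply: cvgM; first exact: exprn_continuous.
have cpath : {for s, continuous (fun s : R => x + s *: (y - x))}.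
  by apply: cvgD; [exact: cvg_cst|apply: cvgZ; [exact: cvg_id|exact: cvg_cst]].
apply: (continuous_comp cpath); apply: within_closure_continuous_at => //.
exact: convex_segment.
Qed.

Lemma integrable_along_segment (phi : R * R -> R) x y j :
  {within closure Omega, continuous phi} -> Omega x -> Omega y ->
  (@lebesgue_measure R).-integrable `[0, 1]
    (EFin \o (fun s : R => s ^+ j * phi (x + s *: (y - x)))).
Proof.
move=> cphi Ox Oy; apply: continuous_compact_integrable.
  exact: segment_compact.
exact: continuous_along_segment.
Qed.

Lemma segment_moment_bounded (phi : R * R -> R) j M x y :
  {within closure Omega, continuous phi} ->
  (forall z, Omega z -> `|phi z| <= M) -> Omega x -> Omega y ->
  `|segment_moment phi j x y| <= M.
Proof.
move=> cphi phiM Ox Oy; have int := integrable_along_segment j cphi Ox Oy.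
apply: le_trans (le_normr_Rintegral _ int) _ => //.
have intc : (@lebesgue_measure R).-integrable `[0, 1] (EFin \o (cst M : R -> R)).
  apply: continuous_compact_integrable; first exact: segment_compact.
  by apply: continuous_subspaceT => ?; exact: cst_continuous.
apply: le_trans (le_Rintegral _ _ intc _) _ => //.
- have : (@lebesgue_measure R).-integrable `[0, 1] (abse \o (EFin \o
      (fun s : R => s ^+ j * phi (x + s *: (y - x))))) by exact: integrable_abse.
  by apply: eq_integrable.
- move=> s /=; rewrite in_itv/= => s01; rewrite normrM -[leRHS]mul1r.
  apply: ler_pM => //; last by apply: phiM; exact: convex_segment.
  by move: s01 => /andP[s0 s1]; rewrite normrX ger0_norm// exprn_ile1.
- rewrite Rintegral_cst//= lebesgue_measure_itv/= lte01 oppr0 adde0.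
  by rewrite mulr1.
Qed.

Lemma is_derive_along (phi g : R * R -> R) (v : R * R) :
  (forall z, Omega z -> derivable phi z v /\ 'D_v phi z = g z) ->
  forall z t, Omega (z + t *: v) ->
    is_derive t (1 : R) (fun t => phi (z + t *: v)) (g (z + t *: v)).
Proof.
move=> dphi z t /dphi[]; rewrite /derivable /derive => dc <-.
have E : (fun h : R => h^-1 *: (phi (h *: v + (z + t *: v)) - phi (z + t *: v))) =
    (fun h : R => h^-1 *: (((fun t => phi (z + t *: v)) \o shift t) (h *: 1)
                           - phi (z + t *: v))).
  apply/funext => h /=.
  suff -> : h *: v + (z + t *: v) = z + (h *: 1 + t) *: v by [].
  by rewrite scalerDl /GRing.scale/= mulr1 addrCA.
by split; [rewrite /derivable -E|rewrite /derive -E].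
Qed.

(** Differentiation under the integral sign, with a constant as dominating
    function. *)
Lemma is_derive_integral (f df : R -> R -> R) (a u v M : R) : a \in `]u, v[ ->
  (forall t, t \in `]u, v[ -> (@lebesgue_measure R).-integrable `[0, 1] (EFin \o f t)) ->
  (forall t s, t \in `]u, v[ -> 0 <= s <= 1 -> is_derive t (1 : R) (f ^~ s) (df t s)) ->
  (forall t s, t \in `]u, v[ -> 0 <= s <= 1 -> `|df t s| <= M) ->
  is_derive a (1 : R) (fun t => \int[@lebesgue_measure R]_(s in `[0, 1]) f t s)
    (\int[@lebesgue_measure R]_(s in `[0, 1]) df a s).
Proof.
move=> auv intf derf dfM.
have m01 : measurable (`[0, 1] : set (measurableTypeR R)) by [].
have intc : (@lebesgue_measure R).-integrable `[0, 1] (EFin \o (cst `|M| : R -> R)).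
  apply: continuous_compact_integrable; first exact: segment_compact.
  by apply: continuous_subspaceT => ?; exact: cst_continuous.
have dfE t s : t \in `]u, v[ -> `[0, 1]%classic s -> partial1of2 f t s = df t s.
  move=> tuv; rewrite /= in_itv/= => s01; rewrite partial1of2E.
  by have := derf t s tuv s01 => ?; rewrite derive_val.
have Mge0 (y : R) : 0 <= (cst `|M| : R -> R) y by exact: normr_ge0.
have derivf t s : `]u, v[%classic t -> `[0, 1]%classic s -> derivable (f ^~ s) t 1.
  by move=> tuv; rewrite /= in_itv/= => s01; have [] := derf t s tuv s01.
have bnd t s : `]u, v[%classic t -> `[0, 1]%classic s ->
    `|partial1of2 f t s| <= (cst `|M| : R -> R) s.
  move=> tuv s01; rewrite dfE//; apply: le_trans (ler_norm M).
  by apply: dfM => //; move: s01; rewrite /= in_itv.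
have D := @derivable_under_integral R _ _ (@lebesgue_measure R) f _ m01 a u v auv
  intf derivf (cst `|M|) Mge0 intc bnd.
split => //; rewrite -derive1E.
rewrite (@differentiation_under_integral R _ _ (@lebesgue_measure R) f _ m01 a u v auv
  intf derivf (cst `|M|) Mge0 intc bnd).
by apply: eq_Rintegral => s; rewrite inE => s01; exact: dfE.
Qed.

Lemma is_derive_segment_moment (phi g : R * R -> R) j x z v t a b :
  {within closure Omega, continuous phi} -> {within closure Omega, continuous g} ->
  (forall z, Omega z -> derivable phi z v /\ 'D_v phi z = g z) ->
  Omega x -> t \in `]a, b[ -> (forall t', t' \in `]a, b[ -> Omega (z + t' *: v)) ->
  is_derive t (1 : R) (fun t' => segment_moment phi j x (z + t' *: v))
    (segment_moment g j.+1 x (z + t *: v)).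
Proof.
move=> cphi cg dphi Ox tab Oz; have [M gM] := continuous_bounded Omega_bounded cg.
have split_path t' s :
    x + s *: (z + t' *: v - x) = x + s *: (z - x) + (s * t') *: v.
  by rewrite addrAC scalerDr scalerA addrA.
apply: (@is_derive_integral (fun t' s => s ^+ j * phi (x + s *: (z + t' *: v - x)))
  (fun t' s => s ^+ j.+1 * g (x + s *: (z + t' *: v - x))) t a b M) => //.
- by move=> t' /Oz Ot; exact: integrable_along_segment.
- move=> t' s /Oz Ot s01.
  have := convex_segment Omega_convex Ox Ot s01; rewrite split_path => Os.
  have D := is_derive_along dphi Os.
  have dl : is_derive t' (1 : R) (fun t' => s * t') s.
    by apply: is_derive_eq (is_deriveZ s (is_derive_id t' (1 : R))) _; exact: mulr1.
  have H := is_deriveZ (s ^+ j) (@is_derive1_comp R _ (fun t' => s * t') t' _ _ D dl).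
  under eq_fun do rewrite split_path.
  by refine (is_derive_eq H _); rewrite /GRing.scale/= exprSr; ring.
- move=> t' s /Oz Ot s01; rewrite normrM -[leRHS]mul1r.
  apply: ler_pM => //; last by apply: gM; exact: convex_segment.
  by move: s01 => /andP[s0 s1]; rewrite normrX ger0_norm// exprn_ile1.
Qed.

Lemma Ck_closure_continuous m (phi : R * R -> R) : Ck_closure Omega m phi ->
  {within closure Omega, continuous phi}.
Proof. by case: m => [|m] []. Qed.

(** Each partial derivative raises the order of the moment by one and lowers
    the smoothness of the integrand by one. *)
Lemma smooth_segment_moment (I : Type) (D : I -> Prop) (p x : I -> R * R)
    (delta : R) (nu : I -> R) (nu_ge1 : forall i, D i -> 1 <= nu i)
    (in_Omega : forall i a b, in_box D p delta i a b -> Omega (x i) /\ Omega (a, b))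
    m (phi : R * R -> R) j : Ck_closure Omega m phi ->
  smooth_family D p delta nu m (fun i a b => segment_moment phi j (x i) (a, b)).
Proof.
elim: m phi j => [|m IH] phi j Cphi; have cphi := Ck_closure_continuous Cphi;
  have [M phiM] := continuous_bounded Omega_bounded cphi;
  have bphi : bounded_family D p delta (fun i a b => segment_moment phi j (x i) (a, b))
    by exists M => i a b /in_Omega[Ox Oab]; exact: segment_moment_bounded.
  by split.
have [_ /= dphi] := Cphi.
have [g1 [d1 Cg1]] := dphi (1, 0) (or_introl erefl).
have [g2 [d2 Cg2]] := dphi (0, 1) (or_intror erefl).
apply: (smooth_familyS nu_ge1 bphi _ (IH g1 j.+1 Cg1) (IH g2 j.+1 Cg2)).
move=> i a b iab; have [Di apd bpd] := iab; have [Ox _] := in_Omega _ _ _ iab.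
have itv c t : (t \in `](c - delta), (c + delta)[) = (`|t - c| < delta).
  by rewrite in_itv/= ltr_distl.
have line1 t : (t, b) = (0, b) + t *: (1, 0) :> R * R.
  by congr pair; rewrite /= /GRing.scale/= ?mulr1 ?mulr0 ?add0r ?addr0.
have line2 t : (a, t) = (a, 0) + t *: (0, 1) :> R * R.
  by congr pair; rewrite /= /GRing.scale/= ?mulr1 ?mulr0 ?add0r ?addr0.
split.
- under eq_fun do rewrite line1; rewrite line1.
  apply: (@is_derive_segment_moment phi g1 j (x i) (0, b) (1, 0) a
    ((p i).1 - delta) ((p i).1 + delta)) => //; first exact: Ck_closure_continuous Cg1.
    by rewrite itv.
  by move=> t; rewrite itv -line1 => tp; have [] := in_Omega i t b.
- under eq_fun do rewrite line2; rewrite line2.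
  apply: (@is_derive_segment_moment phi g2 j (x i) (a, 0) (0, 1) b
    ((p i).2 - delta) ((p i).2 + delta)) => //; first exact: Ck_closure_continuous Cg2.
    by rewrite itv.
  by move=> t; rewrite itv -line2 => tp; have [] := in_Omega i a t.
Qed.
End LineIntegrals.

(** * Local expansion and symmetry of the kernel *)

Section Kernel.
Variables (R : realType) (Omega : set (R * R)).
Hypotheses (Omega_open : open Omega) (Omega_convex : convex_set Omega).
Hypothesis Omega_bounded : bounded_set Omega.
Variable sigma : R * R -> R.
Hypothesis sigma_continuous : {within closure Omega, continuous sigma}.
Implicit Types x y z : R * R.

Lemma attenuationE x y : attenuation sigma x y =
  expR (- (enorm (x - y) * segment_moment sigma 0 x y)).
Proof.
rewrite /attenuation /segment_moment; do 3 congr (_ _).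
by apply: eq_Rintegral => s _; rewrite expr0 mul1r.
Qed.

Definition angular_factor (n : nat) (z : R * R) : R * R :=
  multiple_angle n (z.1 * (enorm z)^-1) (z.2 * (enorm z)^-1).

Lemma kernel_nE n x y : x != y -> kernel_n sigma n x y =
  Complex (attenuation sigma x y * (enorm (x - y))^-1 * (angular_factor n (x - y)).1)
    (- (attenuation sigma x y * (enorm (x - y))^-1 * (angular_factor n (x - y)).2)).
Proof.
rewrite -subr_eq0 => xy; have [c s] := cos_sin_parg xy.
rewrite /kernel_n /cexpi /angular_factor -c -s multiple_angleE cosN sinN.
by apply/eqP; rewrite eq_complex/= !mul0r subr0 addr0 mulrN !eqxx.
Qed.

Lemma enormN z : enorm (- z) = enorm z.
Proof. by rewrite /enorm /= !sqrrN. Qed.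

(** Reverse the segment by the substitution s -> 1 - s. *)
Lemma segment_moment0_sym x y : Omega x -> Omega y ->
  segment_moment sigma 0 x y = segment_moment sigma 0 y x.
Proof.
move=> Ox Oy; rewrite /segment_moment.
rewrite Rintegration_by_substitution_onem ?lexx ?ler01//; last first.
  exact: (@continuous_along_segment R Omega Omega_open Omega_convex sigma x y 0).
rewrite /unstable.onem subrr; apply: eq_Rintegral => s _.
rewrite !expr0 !mul1r; congr sigma.
by rewrite scalerBl scale1r addrA subrKC -scalerN opprB.
Qed.

(** Exchanging x and y adds pi to the polar angle and leaves distance and
    attenuation unchanged. *)
Lemma kernel_n_sym n x y : Omega x -> Omega y -> x != y ->
  kernel_n sigma n y x = (-1) ^+ n * kernel_n sigma n x y.
Proof.
move=> Ox Oy xy; rewrite !kernel_nE// 1?eq_sym//.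
have aE : attenuation sigma y x = attenuation sigma x y.
  by rewrite !attenuationE -opprB enormN segment_moment0_sym.
rewrite aE -[y - x]opprB /angular_factor !enormN/= !mulNr multiple_angle_opp/=.
set u := (multiple_angle _ _ _).1; set v := (multiple_angle _ _ _).2.
have -> : (-1) ^+ n = real_complex R ((-1) ^+ n) by rewrite rmorphXn rmorphN1.
by apply/eqP; rewrite eq_complex/=; apply/andP; split; apply/eqP; ring.
Qed.

Lemma normc_le (z : R[i]) : Normc.normc z <= `|complex.Re z| + `|complex.Im z|.
Proof.
case: z => u v /=; rewrite -(@ler_sqr _ (Num.sqrt _)) ?nnegrE ?addr_ge0//.
rewrite sqr_sqrtr ?addr_ge0 ?sqr_ge0// sqrrD !real_normK ?num_real//.
by rewrite addrAC lerDl mulrn_wge0// mulr_ge0.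
Qed.

Variables (X Y : set (R * R)) (delta r0 : R).
Hypothesis X_sub : X `<=` Omega.
Hypothesis r0_gt0 : 0 < r0.
Hypothesis separated : forall x y a b, X x -> Y y ->
  `|a - y.1| < delta -> `|b - y.2| < delta ->
  Omega (a, b) /\ r0 <= enorm (x - (a, b)).

Lemma sum_Complex m (f g : 'I_m -> R) :
  \sum_(k < m) Complex (f k) (g k) = Complex (\sum_(k < m) f k) (\sum_(k < m) g k).
Proof.
elim: m f g => [|m IH] f g; first by rewrite !big_ord0.
by rewrite !big_ord_recr/= IH.
Qed.

Lemma enorm0 : enorm (0 : R * R) = 0.
Proof. by rewrite /enorm/= expr0n/= addr0 sqrtr0. Qed.

(** Real and imaginary parts are products of smooth families indexed by the
    triple (x, y, n), so the constant C does not depend on n. *)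
Lemma kernel_n_expansion m : Ck_closure Omega m sigma ->
  exists2 C : R, 0 <= C & forall (n : nat) x y, X x -> Y y ->
    exists c : nat -> nat -> R[i], forall h a b,
      h < delta -> `|a| <= h -> `|b| <= h ->
      Normc.normc (kernel_n sigma n x (y.1 + a, y.2 + b) -
        \sum_(k < m) \sum_(l < m) c k l * real_complex R (a ^+ k * b ^+ l))
      <= C * (n.+1%:R * h) ^+ m.
Proof.
move=> Csigma; have [B B0 OB] := bounded_set_box Omega_bounded.
pose D (i : (R * R) * (R * R) * nat) := X i.1.1 /\ Y i.1.2.
pose nu (i : (R * R) * (R * R) * nat) : R := i.2.+1%:R.
pose p (i : (R * R) * (R * R) * nat) := i.1.2.
pose x (i : (R * R) * (R * R) * nat) := i.1.1.
pose n (i : (R * R) * (R * R) * nat) := i.2.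
have far i a b : in_box D p delta i a b -> Omega (a, b) /\ r0 <= enorm (x i - (a, b)).
  by move=> [[Xi Yi] ap bp]; exact: separated ap bp.
have in_Omega i a b : in_box D p delta i a b -> Omega (x i) /\ Omega (a, b).
  by move=> iab; have [[Xi _] _ _] := iab; split; [exact: X_sub|have [] := far _ _ _ iab].
have far_x i a b : in_box D p delta i a b -> r0 <= enorm (x i - (a, b)).
  by move=> /far[].
have near_x i a b : in_box D p delta i a b ->
    `|(x i).1 - a| <= B + B /\ `|(x i).2 - b| <= B + B.
  move=> /in_Omega[/OB[x1 x2] /OB[/= a1 b1]].
  by split; rewrite (le_trans (ler_normB _ _))// lerD.
have nu_ge1 i : D i -> 1 <= nu i by rewrite /nu ler1n.
have nu_ge0 i : D i -> 0 <= nu i by rewrite /nu.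
pose E i a b := attenuation sigma (x i) (a, b) * (enorm (x i - (a, b)))^-1.
have sE : smooth_family D p delta nu m E.
  apply: smooth_familyM; last exact: (smooth_inv_dist n near_x r0_gt0 far_x).
  rewrite (_ : (fun i a b => attenuation sigma (x i) (a, b)) =
    (fun i a b => expR (- (enorm (x i - (a, b)) * segment_moment sigma 0 (x i) (a, b))))).
    apply: smooth_expN; apply: smooth_familyM.
      exact: (smooth_dist n near_x r0_gt0 far_x).
    exact: (smooth_segment_moment Omega_open Omega_convex Omega_bounded nu_ge1 in_Omega).
  by apply/funext => i; apply/funext => a; apply/funext => b; rewrite attenuationE.
have [sA1 sA2] := smooth_multiple_angle n near_x r0_gt0 far_x m.
have [C1 C10 T1] := smooth_family_taylor nu_ge0 (smooth_familyM sE sA1).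
have [C2 C20 T2] := smooth_family_taylor nu_ge0 (smooth_familyM sE sA2).
exists (C1 + C2) => [|n' x' y' Xx Yy]; first exact: addr_ge0.
have [P [c1 P1] HP] := T1 ((x', y'), n') (conj Xx Yy).
have [Q [c2 Q2] HQ] := T2 ((x', y'), n') (conj Xx Yy).
exists (fun k l => Complex (c1 k l) (- c2 k l)) => h a b hd ah bh.
have Kab : x' != (y'.1 + a, y'.2 + b).
  have [||||_] := @separated x' y' (y'.1 + a) (y'.2 + b) => //.
  - by rewrite addrAC subrr add0r (le_lt_trans ah).
  - by rewrite addrAC subrr add0r (le_lt_trans bh).
  move=> r0r; apply: contraTneq r0_gt0 => E0.
  by rewrite -leNgt -enorm0 -[X in _ <= enorm X](subrr x') {2}E0.
rewrite kernel_nE//; move: (HP h a b hd ah bh) (HQ h a b hd ah bh).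
rewrite P1 Q2 /E /x /p /n /= -/(angular_factor n' (x' - (y'.1 + a, y'.2 + b))).
rewrite (_ : \sum_(k < m) _ = Complex
    (\sum_(k < m) \sum_(l < m) c1 k l * a ^+ k * b ^+ l)
    (- \sum_(k < m) \sum_(l < m) c2 k l * a ^+ k * b ^+ l)); last first.
  rewrite -sumrN -(sum_Complex (fun k : 'I_m => \sum_(l < m) c1 k l * a ^+ k * b ^+ l)).
  apply: eq_bigr => k _.
  rewrite -sumrN -(sum_Complex (fun l : 'I_m => c1 k l * a ^+ k * b ^+ l)).
  apply: eq_bigr => l _.
  by apply/eqP; rewrite eq_complex/=; apply/andP; split; apply/eqP; ring.
move=> HP' HQ'; rewrite mulrDl; apply: le_trans (normc_le _) _; apply: lerD => //.
by rewrite /= opprK -normrN opprD opprK.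
Qed.

(** The expansion of order one: its polynomial is a constant, equal to the value
    at the centre. *)
Lemma kernel_n_lipschitz_right : Ck_closure Omega 1 sigma ->
  exists2 C : R, 0 <= C & forall (n : nat) x y y' h, X x -> Y y -> Y y' ->
    h < delta -> `|y'.1 - y.1| <= h -> `|y'.2 - y.2| <= h ->
    Normc.normc (kernel_n sigma n x y' - kernel_n sigma n x y) <= C * (n.+1%:R * h).
Proof.
move=> /kernel_n_expansion[C C0 HC]; exists C => // n x y y' h Xx Yy Yy' hd h1 h2.
have [c Hc] := HC n x y Xx Yy.
have h0 : 0 <= h by exact: le_trans h1.
have sum1 z : \sum_(k < 1) \sum_(l < 1) c k l * real_complex R (z.1 ^+ k * z.2 ^+ l) = c 0%N 0%N.
  by rewrite !big_ord_recr !big_ord0/= !add0r !expr0 mulr1 rmorph1 mulr1.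
have := Hc 0 0 0 (le_lt_trans h0 hd); rewrite normr0 lexx => /(_ isT isT).
rewrite !addr0 -surjective_pairing mulr0 expr1 mulr0 (sum1 (0, 0)) => Ky.
have := Hc h _ _ hd h1 h2; rewrite [y.1 + _]addrC [y.2 + _]addrC !subrK.
rewrite -surjective_pairing (sum1 (y' - y)) expr1 => Ky'.
rewrite -(subrKA (c 0%N 0%N)); apply: le_trans (le_normcD _ _) _.
rewrite -[leRHS]addr0; apply: lerD => //.
by rewrite -normcN opprB.
Qed.

End Kernel.

(** * Separable approximation on a grid *)

Section CompactSeparation.
Variable R : realType.

(** A Lebesgue number argument: the radius can be chosen uniformly near each
    point, hence uniformly on the compact set. *)
Lemma compact_in_open (K U : set (R * R)) : compact K -> open U -> K `<=` U ->
  exists2 d : R, 0 < d & forall y a b, K y -> `|a - y.1| < d -> `|b - y.2| < d -> U (a, b).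
Proof.
move=> /compact_near_coveringP cK oU KU.
pose P (d : R) (y : R * R) := forall a b, `|a - y.1| < d -> `|b - y.2| < d -> U (a, b).
have : \forall d \near (0 : R)^'+, K `<=` P d.
  apply: cK => y Ky.
  have /nbhs_ballP[e /= e0 yeU] : nbhs y U by apply: open_nbhs_nbhs; split => //; exact: KU.
  have e20 : 0 < e / 2 by rewrite divr_gt0.
  exists (ball y (e / 2), [set d : R | d < e / 2]) => /=.
    by split; [exact: nbhsx_ballx|exact: nbhs_right_lt].
  move=> [y' d] [/= [y1 y2] de] a b ay by'; apply: yeU.
  have tri (c c' s : R) : ball c (e / 2) c' -> `|s - c'| < d -> ball c e s.
    rewrite /ball/= => cc' sc'; rewrite (splitr e) (le_lt_trans (ler_distD c' _ _))//.
    by rewrite ltrD// distrC (lt_trans sc').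
  by split; [exact: tri _ _ _ y1 ay|exact: tri _ _ _ y2 by'].
move=> near0; near (0 : R)^'+ => d.
have Hd : K `<=` P d by near: d.
by exists d => [|y a b Ky]; [near: d; exact: nbhs_right_gt|exact: Hd].
Unshelve. all: by end_near. Qed.

(** Points within d of Y in the maximum norm stay in Omega and off the closed
    set X; halving d turns the second fact into a lower bound on the
    distance. *)
Lemma compact_separation (Omega X Y : set (R * R)) : open Omega ->
  compact X -> compact Y -> Y `<=` Omega -> X `&` Y = set0 ->
  exists2 d : R, 0 < d & forall x y a b, X x -> Y y ->
    `|a - y.1| < d -> `|b - y.2| < d -> Omega (a, b) /\ d <= enorm (x - (a, b)).
Proof.
move=> oO cX cY YO XY0.
have cloX : closed X by apply: compact_closed => //; exact: norm_hausdorff.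
have [||d d0 Hd] := @compact_in_open Y (Omega `&` ~` X) cY.
- by apply: openI => //; exact: closed_openC.
- move=> y Yy; split; first exact: YO.
  by move=> Xy; have : (X `&` Y) y by []; rewrite XY0.
exists (d / 2) => [|x y a b Xx Yy ay by']; first by rewrite divr_gt0.
have d2d : d / 2 < d by rewrite ltr_pdivrMr// ltr_pMr// ltr1n.
split; first by have [] := Hd y a b Yy (lt_trans ay d2d) (lt_trans by' d2d).
rewrite leNgt; apply/negP => near_x.
have le1 (u v : R) : `|u| <= Num.sqrt (u ^+ 2 + v ^+ 2).
  by rewrite -sqrtr_sqr ler_wsqrtr// lerDl sqr_ge0.
have [] := Hd y x.1 x.2 Yy; last by rewrite -surjective_pairing.
- rewrite (le_lt_trans (ler_distD a _ _))// (splitr d) ltrD//.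
  by apply: le_lt_trans near_x; exact: (le1 (x.1 - a) (x.2 - b)).
- rewrite (le_lt_trans (ler_distD b _ _))// (splitr d) ltrD//.
  by apply: le_lt_trans near_x; rewrite /enorm [_ ^+ 2 + _]addrC; exact: (le1 (x.2 - b) (x.1 - a)).
Qed.
End CompactSeparation.

Section EssentialSupremum.
Context d (T : measurableType d) (R : realType) (mu : {measure set T -> \bar R}).

Lemma Loo_norm_le (D : set T) (f : T -> R[i]) (M : R) : 0 <= M ->
  (forall z, D z -> Normc.normc (f z) <= M) -> (Loo_norm mu D f <= M%:E)%E.
Proof.
move=> M0 fM; rewrite /Loo_norm unlock; case: ifPn => _; last by rewrite lee_fin.
apply/ess_supP/aeW => z /=; rewrite patchE; case: ifPn => [|_]; last by rewrite abse0 lee_fin.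
rewrite inE => Dz /=; rewrite lee_fin ger0_norm ?fM//.
by case: (f z) => u v; exact: sqrtr_ge0.
Qed.

Lemma in_Loo_bounded (D : set T) (f : T -> R[i]) (M : R) :
  measurable_fun setT (fun z => complex.Re (f z)) ->
  measurable_fun setT (fun z => complex.Im (f z)) ->
  (forall z, D z -> Normc.normc (f z) <= M) -> in_Loo mu D f.
Proof.
move=> mRe mIm fM; split; [exact: measurable_funTS..|].
have : (Loo_norm mu D f <= `|M|%:E)%E.
  by apply: Loo_norm_le => // z /fM fzM; exact: le_trans (ler_norm M).
by move=> /le_lt_trans; apply; rewrite ltry.
Qed.

Lemma measurable_finite_range (J : finType) (q : T -> J) (F : J -> R) :
  (forall j, measurable [set z | q z = j]) -> measurable_fun setT (fun z => F (q z)).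
Proof.
move=> mq; rewrite (_ : (fun z => F (q z)) =
    (fun z => \sum_(j <- enum J) F j * \1_[set z | q z = j] z)).
  apply: measurable_sum => j; apply: measurable_funM => //.
apply/funext => z; rewrite big_enum (bigD1 (q z))//= big1.
  by rewrite addr0 indicE mem_set// mulr1.
by move=> j jq; rewrite indicE memNset ?mulr0//= => qj; rewrite qj eqxx in jq.
Qed.
End EssentialSupremum.

Section Grid.
Variable R : realType.

(** The index of the cell containing t is nondecreasing in t, so that its fibres
    are intervals and hence measurable. *)
Lemma interval_partition (B : R) (L : nat) : 0 < B -> (0 < L)%N ->
  exists q : R -> 'I_L, (forall j, measurable [set t : measurableTypeR R | q t = j]) /\
    forall s t, `|s| <= B -> `|t| <= B -> q s = q t -> `|s - t| <= 2 * B / L%:R.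
Proof.
case: L => // L B0 _; pose c : R := L.+1%:R / (2 * B).
have c0 : 0 < c by rewrite divr_gt0// mulr_gt0.
(* The minimum puts the right end point B into the last cell. *)
pose n t := minn (Num.truncn (c * (t + B))) L.
have nP t : (n t < L.+1)%N by rewrite ltnS geq_minr.
exists (fun t => Ordinal (nP t)); split.
- move=> j; apply: is_interval_measurable => s t /= qs qt u /andP[su ut].
  have mono (v w : R) : v <= w -> (n v <= n w)%N.
    move=> vw; rewrite /n leq_min geq_minr andbT (leq_trans (geq_minl _ _))//.
    by apply: le_truncn; rewrite ler_pM2l// lerD2r.
  apply/val_inj/eqP; rewrite /= eqn_leq; apply/andP; split.
    by rewrite -qt; exact: mono.
  by rewrite -qs; exact: mono.
- move=> s t sB tB /(congr1 val)/= nst.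
  have itv (u : R) : `|u| <= B -> (n u)%:R <= c * (u + B) <= (n u).+1%:R.
    rewrite ler_norml => /andP[u1 u2].
    have cu0 : 0 <= c * (u + B) by rewrite mulr_ge0 ?(ltW c0)// -lerBlDr sub0r.
    have /andP[t1 t2] := truncn_itv cu0.
    rewrite /n; case: (leqP (Num.truncn (c * (u + B))) L) => [tL|Lt].
      by rewrite t1 ltW.
    rewrite (le_trans _ t1) ?ler_nat 1?ltnW//=.
    rewrite -[leRHS](@divfK _ (2 * B)) ?gt_eqF ?mulr_gt0// -/c ler_pM2l//.
    by rewrite [2 * B]mulr_natl mulr2n lerD2r.
  have /andP[s1 s2] := itv s sB; have /andP[t1 t2] := itv t tB.
  rewrite -(ler_pM2l c0) -{1}(gtr0_norm c0) -normrM.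
  rewrite (_ : c * (2 * B / _) = 1); last first.
    by rewrite /c mulrA divfK ?gt_eqF ?mulr_gt0// divff// pnatr_eq0.
  rewrite nst in s1 s2; rewrite -natr1 in s2 t2.
  rewrite ler_norml; apply/andP; split; lra.
Qed.

Lemma square_partition (B h : R) (L : nat) : 0 < B -> (0 < L)%N -> 2 * B / L%:R <= h ->
  exists q : R * R -> 'I_L * 'I_L,
    (forall j, measurable [set z : measurableTypeR R * measurableTypeR R | q z = j]) /\
    forall y z, `|y.1| <= B /\ `|y.2| <= B -> `|z.1| <= B /\ `|z.2| <= B -> q y = q z ->
      `|y.1 - z.1| <= h /\ `|y.2 - z.2| <= h.
Proof.
move=> B0 L0 Lh; have [q [mq qP]] := interval_partition B0 L0.
exists (fun z => (q z.1, q z.2)); split.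
  move=> [j1 j2]; have := measurableX (mq j1) (mq j2).
  congr measurable; apply/seteqP; split=> z /=; first by move=> [-> ->].
  by move=> [].
move=> y z [y1 y2] [z1 z2] [q1 q2].
by split; apply: le_trans Lh; exact: qP.
Qed.

Lemma normc_ge0 (z : R[i]) : 0 <= Normc.normc z.
Proof. by case: z => u v; exact: sqrtr_ge0. Qed.

Lemma normc_real (t : R) : Normc.normc (real_complex R t) = `|t|.
Proof. by rewrite /Normc.normc/= expr0n/= addr0 sqrtr_sqr. Qed.

(** For x and y in given cells, f_l (x) is a coefficient of the expansion for
    the node of the cell of x, and g_l (y) is a monomial centred at the node of
    the cell of y, cut off outside that cell.  For each y only the m^2 terms of
    its own cell survive.  E2 is the price of moving x to its node, E1 that of
    the expansion. *)
Lemma low_rank_approximation (K : R * R -> R * R -> R[i]) (X Y : set (R * R))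
    (xc yc : R * R) (B h h' E1 E2 : R) (m L : nat) :
  X xc -> Y yc -> 0 < B ->
  (forall x, X x -> `|x.1| <= B /\ `|x.2| <= B) ->
  (forall y, Y y -> `|y.1| <= B /\ `|y.2| <= B) ->
  (forall x y, X x -> Y y -> exists c : nat -> nat -> R[i],
    forall y', Y y' -> `|y'.1 - y.1| <= h -> `|y'.2 - y.2| <= h ->
    Normc.normc (K x y' - \sum_(k < m) \sum_(l < m) c k l *
      real_complex R ((y'.1 - y.1) ^+ k * (y'.2 - y.2) ^+ l)) <= E1) ->
  0 < h' ->
  (forall x x' y, X x -> X x' -> Y y ->
    `|x'.1 - x.1| <= h' -> `|x'.2 - x.2| <= h' -> Normc.normc (K x' y - K x y) <= E2) ->
  (0 < L)%N -> 2 * B / L%:R <= h ->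
  exists (N : nat) (f g : 'I_N -> R * R -> R[i]),
    [/\ N = (L * L * (m * m))%N,
        forall l, in_Loo (lebesgue2 R) X (f l),
        forall l, in_Loo (lebesgue2 R) Y (g l) &
        forall x y, X x -> Y y ->
          Normc.normc (K x y - \sum_(l < N) f l x * g l y) <= E1 + E2].
Proof.
move=> Xxc Yyc B0 XB YB expand h'0 lip L0 Lh.
have [qy [mqy qyP]] := square_partition B0 L0 Lh.
(* The mesh of the partition on the x side does not enter the number of terms. *)
pose L' := (Num.truncn (2 * B / h')).+1.
have L'h : 2 * B / L'%:R <= h'.
  rewrite ler_pdivrMr ?ltr0n// -ler_pdivrMl// mulrC ltW//.
  exact: truncnS_gt.
have [qx [mqx qxP]] := square_partition B0 (ltn0Sn _ : (0 < L')%N) L'h.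
(* The default values keep the nodes in Y and X even for cells that miss these
   sets. *)
pose y0 j := xget yc [set y | Y y /\ qy y = j].
pose x0 i := xget xc [set x | X x /\ qx x = i].
have Yy0 j : Y (y0 j) by rewrite /y0; case: xgetP => [y _ []|].
have Xx0 i : X (x0 i) by rewrite /x0; case: xgetP => [x _ []|].
have qy0 y : Y y -> qy (y0 (qy y)) = qy y.
  by move=> Yy; have [] : [set y' | Y y' /\ qy y' = qy y] (y0 (qy y)) by apply: xgetPex; exists y.
have qx0 x : X x -> qx (x0 (qx x)) = qx x.
  by move=> Xx; have [] : [set x' | X x' /\ qx x' = qx x] (x0 (qx x)) by apply: xgetPex; exists x.
have [c cP] := choice (fun ij : ('I_L' * 'I_L') * ('I_L * 'I_L) =>
  expand (x0 ij.1) (y0 ij.2) (Xx0 _) (Yy0 _)).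
pose T : finType := (('I_L * 'I_L) * ('I_m * 'I_m))%type.
pose mono (t : T) (y : R * R) : R :=
  (y.1 - (y0 t.1).1) ^+ t.2.1 * (y.2 - (y0 t.1).2) ^+ t.2.2.
pose F (t : T) x := c (qx x, t.1) t.2.1 t.2.2.
pose G (t : T) y := real_complex R ((qy y == t.1)%:R * mono t y).
exists #|T|, (fun l => F (enum_val l)), (fun l => G (enum_val l)); split.
- by rewrite !card_prod !card_ord.
- move=> l; set t := enum_val l.
  apply: (@in_Loo_bounded _ _ _ _ _ _ (\sum_i Normc.normc (c (i, t.1) t.2.1 t.2.2))).
  + exact: (measurable_finite_range (fun i => complex.Re (c (i, t.1) t.2.1 t.2.2)) mqx).
  + exact: (measurable_finite_range (fun i => complex.Im (c (i, t.1) t.2.1 t.2.2)) mqx).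
  + move=> x _; rewrite (bigD1 (qx x))//= lerDl sumr_ge0// => i _; exact: normc_ge0.
- move=> l; set t := enum_val l.
  apply: (@in_Loo_bounded _ _ _ _ _ _ ((2 * B) ^+ t.2.1 * (2 * B) ^+ t.2.2)).
  + rewrite /G /=; apply: measurable_funM.
      exact: (measurable_finite_range (fun j => (j == t.1)%:R) mqy).
    by apply: measurable_funM; apply: measurable_funX; apply: measurable_funB.
  + exact: measurable_cst.
  + move=> y Yy; rewrite normc_real !normrM !normrX.
    have d1 (a b : R) n : `|a| <= B -> `|b| <= B -> `|a - b| ^+ n <= (2 * B) ^+ n.
      move=> aB bB; apply: lerXn2r; rewrite ?nnegrE ?mulr_ge0 ?(ltW B0)//.
      by rewrite mulr_natl mulr2n (le_trans (ler_normB _ _))// lerD.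
    have [y1 y2] := YB _ Yy; have [z1 z2] := YB _ (Yy0 t.1).
    rewrite -[leRHS]mul1r; apply: ler_pM => //.
      by case: eqP => _; rewrite ?normr1 ?normr0.
    by apply: ler_pM; rewrite ?exprn_ge0 ?d1.
- move=> x y Xx Yy.
  have -> : \sum_(l < #|T|) F (enum_val l) x * G (enum_val l) y =
      \sum_(k < m) \sum_(l < m) c (qx x, qy y) k l *
        real_complex R ((y.1 - (y0 (qy y)).1) ^+ k * (y.2 - (y0 (qy y)).2) ^+ l).
    rewrite -(big_enum_val (fun t => F t x * G t y)) /=.
    rewrite (eq_bigr (fun t : T => F (t.1, t.2) x * G (t.1, t.2) y)); last by move=> [].
    rewrite -(pair_bigA _ (fun j kl => F (j, kl) x * G (j, kl) y))/= (bigD1 (qy y))//=.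
    rewrite [X in _ + X]big1 ?addr0 => [|j jy]; last first.
      by rewrite big1// => kl _; rewrite /G/= eq_sym (negbTE jy) mul0r rmorph0 mulr0.
    rewrite pair_big/=; apply: eq_bigr => kl _.
    by rewrite /F /G /mono/= eqxx mul1r.
  have [y1 y2] := qyP _ _ (YB _ Yy) (YB _ (Yy0 _)) (esym (qy0 _ Yy)).
  have [x1 x2] := qxP _ _ (XB _ Xx) (XB _ (Xx0 _)) (esym (qx0 _ Xx)).
  rewrite -(subrKA (K (x0 (qx x)) y)); apply: le_trans (le_normcD _ _) _.
  rewrite addrC; apply: lerD.
    exact: (cP (qx x, qy y) y Yy y1 y2).
  exact: lip.
Qed.
End Grid.

(** * Choice of the parameters *)

Section Assembly.
Variable R : realType.

Lemma Ck_closureW (Omega : set (R * R)) m (f : R * R -> R) :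
  Ck_closure Omega m.+1 f -> Ck_closure Omega m f.
Proof.
elim: m f => [|m IH] f [cf df]; split => //.
move=> v /df[g [dg Cg]]; exists g; split => //; exact: IH.
Qed.

Lemma Ck_closure1 (Omega : set (R * R)) m (f : R * R -> R) :
  Ck_closure Omega m.+1 f -> Ck_closure Omega 1 f.
Proof. by elim: m => // m IH /Ck_closureW/IH. Qed.

(** With e = eps^(1/m) all real powers of eps that occur become integer powers
    of e. *)
Lemma powR_root (eps : R) (m : nat) : 0 < eps -> eps < 1 -> (0 < m)%N ->
  exists e : R, [/\ 0 < e, e <= 1, e ^+ m = eps & eps `^ (- (4 / m%:R)) = (e ^+ 4)^-1].
Proof.
move=> eps0 eps1 m0; pose e := eps `^ m%:R^-1.
have e0 : 0 < e by exact: powR_gt0.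
have em : e ^+ m = eps.
  by rewrite -powR_mulrn ?(ltW e0)// -powRrM mulVf ?pnatr_eq0 -?lt0n// powRr1// ltW.
exists e; split => //.
- rewrite leNgt; apply/negP => e1.
  have : 1 < e ^+ m by rewrite exprn_egt1// -lt0n.
  by rewrite em (lt_gtF eps1).
- by rewrite powRN -powR_mulrn ?(ltW e0)// -powRrM mulrC.
Qed.

Lemma normc_sign n (z : R[i]) : Normc.normc ((-1) ^+ n * z) = Normc.normc z.
Proof. by rewrite -signr_odd mulr_sign; case: odd => //; rewrite normcN. Qed.

End Assembly.
Unset Implicit Arguments.

Theorem theorem3p13 (R : realType) (Omega : set (R * R)) (k : nat)
    (sigma_t : R * R -> R) (sigma0 sigma1 : R)
    (X Y : set (R * R)) (xc yc : R * R) (rho zeta eta : R)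
    (Omega_open : open Omega)
    (Omega_convex : convex_set Omega)
    (Omega_bounded : bounded_set Omega)
    (k_ge1 : (1 <= k)%N)
    (sigma_Ck : Ck_closure Omega k.+1 sigma_t)
    (sigma0_gt0 : 0 < sigma0)
    (sigma_bounds : forall x, closure Omega x ->
       sigma0 <= sigma_t x /\ sigma_t x <= sigma1)
    (X_compact : compact X) (Y_compact : compact Y)
    (X_sub : X `<=` Omega) (Y_sub : Y `<=` Omega)
    (XY_disjoint : X `&` Y = set0)
    (xcX : X xc) (ycY : Y yc)
    (rhoE : enorm (xc - yc) = rho)
    (zetaE : sup [set enorm (xc - x) | x in X] = zeta)
    (etaE : sup [set enorm (yc - y) | y in Y] = eta)
    (separated : (zeta + eta) / rho < 1 / 2) :
  exists C eps0 : R, 0 < eps0 /\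
    forall (n : nat) (eps : R), 0 < eps ->
      exists (N : nat) (f g : 'I_N -> R * R -> R[i]),
        [/\ forall l, in_Loo (lebesgue2 R) X (f l),
            forall l, in_Loo (lebesgue2 R) Y (g l),
            (Loo_norm (lebesgue22 R) (X `*` Y)
               (fun p : (R * R) * (R * R) => kernel_n sigma_t n p.1 p.2 -
                         \sum_(l < N) f l p.1 * g l p.2)%R
             <= eps%:E)%E
          & eps < eps0 ->
            N%:R <= C * (n%:R + `|ln eps|) ^+ 2 * eps `^ (- (4 / k.+1%:R))].
Proof.
have YX_disjoint : Y `&` X = set0 by rewrite setIC.
have [B B0 OB] := bounded_set_box Omega_bounded.
have [d d0 sepXY] := compact_separation Omega_open X_compact Y_compact Y_sub XY_disjoint.
have [d' d'0 sepYX] := compact_separation Omega_open Y_compact X_compact X_sub YX_disjoint.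
have csigma := Ck_closure_continuous sigma_Ck.
have [C1 C10 expand] := kernel_n_expansion Omega_open Omega_convex Omega_bounded
  X_sub d0 sepXY sigma_Ck.
have [C2 C20 lip] := kernel_n_lipschitz_right Omega_open Omega_convex Omega_bounded
  Y_sub d'0 sepYX (Ck_closure1 sigma_Ck).
pose m := k.+1.
(* h will be tau e / (n + 1) with e = eps^(1/(k+1)): the expansion then has
   error C1 (tau e)^(k+1) <= C1 tau eps <= eps / 2, and h < d. *)
pose tau := Num.min (d / 2) (Num.min 1 (2 * (C1 + 1))^-1).
have C1p : 0 < C1 + 1 by rewrite ltr_wpDl.
have C2p : 0 < C2 + 1 by rewrite ltr_wpDl.
have tau0 : 0 < tau by rewrite !lt_min divr_gt0//= ltr01 invr_gt0 mulr_gt0.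
have taud : tau < d by rewrite gt_min ltr_pdivrMr// ltr_pMr// ltr1n.
have tau1 : tau <= 1 by rewrite !ge_min lexx orbT.
have tauC : C1 * tau <= 2^-1.
  apply: (@le_trans _ _ ((C1 + 1) * (2 * (C1 + 1))^-1)).
    by apply: ler_pM; rewrite ?(ltW tau0)// ?lerDl// !ge_min lexx !orbT.
  by rewrite invfM mulrCA divff ?mulr1// gt_eqF.
pose A := 2 * B / tau + 1.
have A0 : 0 <= 2 * B / tau by rewrite divr_ge0 ?mulr_ge0// ltW.
suff small : forall n (eps : R), 0 < eps -> eps < expR (- 1) ->
  exists (N : nat) (f g : 'I_N -> R * R -> R[i]),
        [/\ forall l, in_Loo (lebesgue2 R) X (f l),
            forall l, in_Loo (lebesgue2 R) Y (g l),
            (Loo_norm (lebesgue22 R) (X `*` Y)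
               (fun p : (R * R) * (R * R) => kernel_n sigma_t n p.1 p.2 -
                         \sum_(l < N) f l p.1 * g l p.2)%R
             <= eps%:E)%E
          & N%:R <= (A ^+ 2 * m%:R ^+ 2) * (n%:R + `|ln eps|) ^+ 2 * eps `^ (- (4 / k.+1%:R))].
  exists (A ^+ 2 * m%:R ^+ 2), (expR (- 1)); split => [|n eps eps_gt0]; first exact: expR_gt0.
  have [lt|ge] := ltP eps (expR (- 1)).
    by have [N [f [g [? ? ? ?]]]] := small n eps eps_gt0 lt; exists N, f, g; split.
  (* The number of terms is only bounded for small eps: for larger eps take the
     approximation obtained for a smaller accuracy. *)
have eps'_gt0 : 0 < expR (- 1) / 2 :> R by rewrite divr_gt0// expR_gt0.
  have eps'_lt : expR (- 1) / 2 < expR (- 1) :> R.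
    by rewrite ltr_pdivrMr// ltr_pMr ?expR_gt0// ltr1n.
  have [N [f [g [inX inY err _]]]] := small n _ eps'_gt0 eps'_lt.
  exists N, f, g; split => //.
  by apply: le_trans err _; rewrite lee_fin (le_trans (ltW eps'_lt)).
move=> n eps eps_gt0 eps_lt.
have eps1 : eps < 1 by rewrite (lt_trans eps_lt)// expR_lt1 oppr_lt0.
have [e [e0 e1 em ->]] := powR_root eps_gt0 eps1 (ltn0Sn k).
pose nu : R := n.+1%:R.
have nu1 : 1 <= nu by rewrite ler1n.
have nu0 : 0 < nu by exact: lt_le_trans nu1.
have ln1 : 1 <= `|ln eps|.
  have lnN : ln eps < -1 by rewrite -[ltRHS]expRK ltr_ln ?posrE ?expR_gt0.
  by rewrite ltr0_norm ?(lt_trans lnN)// lerNr ltW.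
pose h := tau * e / nu.
have h0 : 0 < h by rewrite divr_gt0// mulr_gt0.
have htau : h <= tau.
  rewrite ler_pdivrMr//; apply: ler_pM => //; rewrite ?(ltW tau0) ?(ltW e0)//.
  exact: le_trans nu1.
pose L := (Num.truncn (2 * B / h)).+1.
have L0 : (0 < L)%N by [].
have Lh : 2 * B / L%:R <= h.
  rewrite ler_pdivrMr ?ltr0n// -ler_pdivrMl// mulrC ltW//.
  exact: truncnS_gt.
have LA : L%:R <= A * (nu / e).
  have nue : 1 <= nu / e by rewrite ler_pdivlMr// mul1r (le_trans e1).
  rewrite /L /A -natr1 [leRHS]mulrDl mul1r. apply: lerD => //.
  apply: (@le_trans _ _ (2 * B / h)).
    by rewrite truncn_le; apply: divr_ge0; [rewrite mulr_ge0 ?(ltW B0)|exact: ltW].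
  rewrite /h le_eqVlt; apply/orP; left; apply/eqP; field.
  by rewrite !gt_eqF.
pose h' := Num.min (d' / 2) (eps / 2 / ((C2 + 1) * nu)).
have h'0 : 0 < h' by rewrite lt_min !divr_gt0// mulr_gt0.
have h'd : h' < d' by rewrite gt_min ltr_pdivrMr// ltr_pMr// ltr1n.
have XB x : X x -> `|x.1| <= B /\ `|x.2| <= B by move=> /X_sub/OB.
have YB y : Y y -> `|y.1| <= B /\ `|y.2| <= B by move=> /Y_sub/OB.
have expand_n x y : X x -> Y y -> exists c : nat -> nat -> R[i],
    forall y', Y y' -> `|y'.1 - y.1| <= h -> `|y'.2 - y.2| <= h ->
    Normc.normc (kernel_n sigma_t n x y' - \sum_(a < m) \sum_(b < m) c a b *
      real_complex R ((y'.1 - y.1) ^+ a * (y'.2 - y.2) ^+ b)) <= eps / 2.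
  move=> Xx Yy; have [c cP] := expand n x y Xx Yy; exists c => y' _ y1 y2.
  have := cP h _ _ (le_lt_trans htau taud) y1 y2.
  rewrite [y.1 + _]addrC [y.2 + _]addrC !subrK -surjective_pairing => /le_trans; apply.
  have -> : n.+1%:R * h = tau * e by rewrite /h mulrC divfK// gt_eqF.
  rewrite exprMn em mulrA mulrC ler_wpM2l ?(ltW eps_gt0)//.
  apply: le_trans tauC; rewrite ler_wpM2l// exprS ler_piMr ?(ltW tau0)//.
  by rewrite exprn_ile1 ?(ltW tau0).
have lip_n x x' y : X x -> X x' -> Y y -> `|x'.1 - x.1| <= h' -> `|x'.2 - x.2| <= h' ->
    Normc.normc (kernel_n sigma_t n x' y - kernel_n sigma_t n x y) <= eps / 2.
  move=> Xx Xx' Yy x1 x2.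
  have ne z : X z -> y != z.
    move=> Xz; apply/eqP => yz; have : (Y `&` X) y by split => //; rewrite yz.
    by rewrite YX_disjoint.
  rewrite !(kernel_n_sym Omega_open Omega_convex csigma n (x := y)) ?ne//;
    do ?[exact: X_sub|exact: Y_sub].
  rewrite -mulrBr normc_sign; apply: le_trans (lip n y x x' h' Yy Xx Xx' h'd x1 x2) _.
  apply: (@le_trans _ _ ((C2 + 1) * nu * h')).
    by rewrite -mulrA ler_wpM2r ?lerDl// mulr_ge0// ltW.
  by rewrite mulrC -ler_pdivlMr ?mulr_gt0// ge_min lexx orbT.
have [N [f [g [NE inX inY err]]]] :=
  low_rank_approximation xcX ycY B0 XB YB expand_n h'0 lip_n L0 Lh.
exists N, f, g; split => //.
  apply: Loo_norm_le => [|[x y] [/= Xx Yy]]; first exact: ltW.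
  by rewrite (splitr eps); exact: err.
have e40 : 0 < e ^+ 4 by rewrite exprn_gt0.
have nuln : nu <= n%:R + `|ln eps| by rewrite /nu -natr1 lerD2l.
apply: (@le_trans _ _ ((A * (nu / e)) ^+ 2 * m%:R ^+ 2)).
  by rewrite NE !natrM -!expr2 ler_wpM2r ?exprn_ge0// lerXn2r ?nnegrE// (le_trans _ LA).
rewrite (exprMn _ A) mulrAC -[leRHS]mulrA ler_wpM2l ?mulr_ge0 ?exprn_ge0 ?addr_ge0//.
rewrite exprMn exprVn; apply: ler_pM.
- by rewrite exprn_ge0 ?(ltW nu0).
- by rewrite invr_ge0 exprn_ge0// ltW.
- by rewrite lerXn2r ?nnegrE ?(ltW nu0)// (le_trans (ltW nu0)).
- by rewrite lef_pV2 ?posrE ?exprn_gt0// ler_wiXn2l// ltW.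
Qed.
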